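(* Let $I\subset\mathbb{R}$ be an open interval and let $N_0:I\to H^2$, $N_1:I\to S^2_1$ be real-analytic maps satisfying $\langle N_1(t),N_0(t)\rangle=0$ for all $t\in I$ and $\langle N_1(t),N_0'(t)-N_1(t)\rangle\not\equiv 0$ on $I$. Then there exists a Lorentz harmonic map $\nu:I\times I\to H^2$, $(x,y)\mapsto\nu(x,y)$, with $(x,y)$ null coordinates, such that $\nu(t,t)=N_0(t)$ and $\nu_x(t,t)=N_1(t)$ for all $t\in I$.
   Context: $\mathfrak{sl}(2,\mathbb{R})$ is the space of real traceless $2\times2$ matrices with the Lorentzian inner product $\langle X,Y\rangle$ determined by $\langle X,X\rangle=-\det X$ (so $\mathfrak{sl}(2,\mathbb{R})\cong\mathbb{R}^{2,1}$). $H^2=\{X\in\mathfrak{sl}(2,\mathbb{R}):\langle X,X\rangle=-1\}$ and $S^2_1=\{X\in\mathfrak{sl}(2,\mathbb{R}):\langle X,X\rangle=1\}$. $I\times I$ carries the Lorentzian metric $dx\,dy$ (null coordinates $(x,y)$). A smooth map $\nu:I\times I\to H^2$ is Lorentz harmonic iff $\nu_{xy}$ is pointwise parallel to $\nu$. *)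

(* Defs.v *)
From Stdlib Require Import Reals.
From Coquelicot Require Import Coquelicot.
Open Scope R_scope.

(* An element of sl(2,R) is a real traceless 2x2 matrix  [[a, b], [c, -a]];
   we store it by its coordinates (a, b, c) in the standard basis. *)
Record sl2 := SL2 { sl_a : R; sl_b : R; sl_c : R }.

Definition sl2_det (X : sl2) : R :=
  sl_a X * (- sl_a X) - sl_b X * sl_c X.

Definition sl2_add (X Y : sl2) : sl2 :=
  SL2 (sl_a X + sl_a Y) (sl_b X + sl_b Y) (sl_c X + sl_c Y).
Definition sl2_scal (k : R) (X : sl2) : sl2 :=
  SL2 (k * sl_a X) (k * sl_b X) (k * sl_c X).
Definition sl2_sub (X Y : sl2) : sl2 := sl2_add X (sl2_scal (-1) Y).

(* The Lorentzian inner product: the symmetric bilinear form with <X,X> = -det X,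
   obtained by polarization. *)
Definition ip (X Y : sl2) : R :=
  (- sl2_det (sl2_add X Y) + sl2_det X + sl2_det Y) / 2.

Definition in_H2 (X : sl2) : Prop := ip X X = -1.
Definition in_S21 (X : sl2) : Prop := ip X X = 1.

Definition in_I (lo hi : Rbar) (t : R) : Prop := Rbar_lt lo t /\ Rbar_lt t hi.

Definition real_analytic_on (lo hi : Rbar) (f : R -> R) : Prop :=
  forall t0, in_I lo hi t0 ->
    exists (a : nat -> R) (r : R), 0 < r /\
      forall t, Rabs (t - t0) < r -> is_pseries a (t - t0) (f t).

Definition sl2_analytic_on (lo hi : Rbar) (N : R -> sl2) : Prop :=
  real_analytic_on lo hi (fun t => sl_a (N t)) /\
  real_analytic_on lo hi (fun t => sl_b (N t)) /\
  real_analytic_on lo hi (fun t => sl_c (N t)).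

Definition sl2_Derive (N : R -> sl2) (t : R) : sl2 :=
  SL2 (Derive (fun s => sl_a (N s)) t)
      (Derive (fun s => sl_b (N s)) t)
      (Derive (fun s => sl_c (N s)) t).

Definition smooth2_on (U : R -> R -> Prop) (f : R -> R -> R) : Prop :=
  exists D : nat -> nat -> R -> R -> R,
    D O O = f /\
    forall i j x y, U x y ->
      is_derive (fun x' => D i j x' y) x (D (S i) j x y) /\
      is_derive (fun y' => D i j x y') y (D i (S j) x y) /\
      continuous (fun p : R * R => D i j (fst p) (snd p)) (x, y).

Definition sl2_smooth2_on (U : R -> R -> Prop) (nu : R -> R -> sl2) : Prop :=
  smooth2_on U (fun x y => sl_a (nu x y)) /\
  smooth2_on U (fun x y => sl_b (nu x y)) /\
  smooth2_on U (fun x y => sl_c (nu x y)).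

Definition d_x (nu : R -> R -> sl2) (x y : R) : sl2 :=
  sl2_Derive (fun x' => nu x' y) x.
Definition d_y (nu : R -> R -> sl2) (x y : R) : sl2 :=
  sl2_Derive (fun y' => nu x y') y.
Definition d_xy (nu : R -> R -> sl2) (x y : R) : sl2 :=
  d_y (d_x nu) x y.

Definition in_IxI (lo hi : Rbar) (x y : R) : Prop := in_I lo hi x /\ in_I lo hi y.

(* A smooth map nu : I x I -> H^2 is Lorentz harmonic (for the metric dx dy)
   iff nu_xy is pointwise parallel to nu. *)
Definition lorentz_harmonic (lo hi : Rbar) (nu : R -> R -> sl2) : Prop :=
  sl2_smooth2_on (in_IxI lo hi) nu /\
  (forall x y, in_IxI lo hi x y -> in_H2 (nu x y)) /\
  (forall x y, in_IxI lo hi x y ->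
     exists lam : R, d_xy nu x y = sl2_scal lam (nu x y)).

(* Main.v *)
Require Import Defs.
From Stdlib Require Import Reals Lra Lia Nsatz.
From Coquelicot Require Import Coquelicot.
Open Scope R_scope.

(** Complete [N0], [N1] to an orthonormal frame by [J], half their commutator,
    and write [N0' = (1 + p) N1 + q J], [N1' = (1 + p) N0 + kap J],
    [J' = q N0 - kap N1] along the curve. A wave map frame [(nu, nu_x, e2)] over
    the square satisfies [e_x = M e], [e_y = M' e] with coefficients [p], [q],
    [kap] subject to [kap_y = - q], [p_x = kap q], [q_x = - kap p]. Since
    [(p, q)] is the rotation of its diagonal value by an angle [phi] with
    [phi_x = kap], these equations amount to the scalar sine-Gordon type equation
    [phi_xy = p0 (y) sin phi - q0 (y) cos phi], whose right-hand side is globally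
    Lipschitz in [phi]; so the solution exists on the whole square. The entries
    of [nu] then solve the linear equation [nu_xy = p nu]. Both Cauchy problems
    are solved by Picard iteration in norms weighted by [exp (k |x - y|)].
    Finally the tensor [- nu nu + nu_x nu_x + e2 e2] does not depend on [y] and
    is the inverse metric on the diagonal, which forces [<nu, nu> = -1]. *)

(** * Orthonormal frames of sl(2,R) and the inverse metric *)

(* For an orthonormal pair, half the commutator completes the frame. *)
Definition half_bracket (X Y : sl2) : sl2 :=
  SL2 ((sl_b X * sl_c Y - sl_b Y * sl_c X) / 2)
      (sl_a X * sl_b Y - sl_b X * sl_a Y)
      (sl_c X * sl_a Y - sl_a X * sl_c Y).

Lemma ip_coord X Y :
  ip X Y = sl_a X * sl_a Y + (sl_b X * sl_c Y + sl_c X * sl_b Y) / 2.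
Proof. unfold ip, sl2_det, sl2_add; simpl. field. Qed.

Lemma sl2_ext X Y : sl_a X = sl_a Y -> sl_b X = sl_b Y -> sl_c X = sl_c Y -> X = Y.
Proof. destruct X, Y; simpl; intros; subst; reflexivity. Qed.

Lemma orthonormal_coord X Y :
  in_H2 X -> in_S21 Y -> ip Y X = 0 ->
  sl_a X * sl_a X + sl_b X * sl_c X = -1 /\ sl_a Y * sl_a Y + sl_b Y * sl_c Y = 1 /\
  sl_b Y * sl_c X = - (2 * sl_a X * sl_a Y) - sl_b X * sl_c Y.
Proof. unfold in_H2, in_S21. rewrite !ip_coord. intros. repeat split; lra. Qed.

(** Traceless matrices satisfy [X Y + Y X = 2 <X,Y> Id]. Hence an orthonormal pair anticommutes,
    with squares [-Id] and [Id]; half the commutator is then the matrix product [X Y], and both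
    identities follow by associativity. The proof checks them in coordinates. *)
Lemma half_bracket_frame X Y :
  in_H2 X -> in_S21 Y -> ip Y X = 0 ->
  half_bracket (half_bracket X Y) Y = X /\
  half_bracket X (half_bracket X Y) = sl2_scal (-1) Y.
Proof.
  intros H1 H2 H3. destruct (orthonormal_coord X Y H1 H2 H3) as (E1 & E2 & E3).
  destruct X as [a b c], Y as [a' b' c']; simpl in *.
  split; apply sl2_ext; simpl; apply (Rmult_eq_reg_l 2); try lra; field_simplify; cbn [pow]; clear H1 H2 H3; nsatz.
Qed.

(* The tensor [- X0 X0 + X1 X1 + X2 X2] is the inverse of the metric, whose only nonzero entries are 1 at (a, a) and 2 at (b, c). *)
Definition dual_frame (X0 X1 X2 : sl2) : Prop :=
  let g f1 f2 := - (f1 X0 * f2 X0) + f1 X1 * f2 X1 + f1 X2 * f2 X2 in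
  g sl_a sl_a = 1 /\ g sl_a sl_b = 0 /\ g sl_a sl_c = 0 /\
  g sl_b sl_b = 0 /\ g sl_b sl_c = 2 /\ g sl_c sl_c = 0.

(** The half commutator is a unit spacelike vector orthogonal to [X] and [Y], so the three vectors
    form an orthonormal basis of signature (-,+,+), and such a basis reproduces the inverse
    metric. *)
Lemma dual_frame_of_orthonormal X Y :
  in_H2 X -> in_S21 Y -> ip Y X = 0 -> dual_frame X Y (half_bracket X Y).
Proof.
  intros H1 H2 H3. destruct (orthonormal_coord X Y H1 H2 H3) as (E1 & E2 & E3).
  destruct X as [a b c], Y as [a' b' c']; simpl in *. clear H1 H2 H3.
  assert (F1 : b * c = -1 - a * a) by lra. assert (F2 : b' * c' = 1 - a' * a') by lra.
  assert (F3 : b * c' + b' * c = - (2 * a * a')) by lra.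
  refine (conj _ (conj _ (conj _ (conj _ (conj _ _))))); simpl.
  (* The squared difference is traded for the squared sum minus four times the product, since only
     [b * c' + b' * c], [b * c] and [b' * c'] are known. *)
  - replace (- (a * a) + a' * a' + (b * c' - b' * c) / 2 * ((b * c' - b' * c) / 2)) with
      (- (a * a) + a' * a' + (b * c' + b' * c) * (b * c' + b' * c) / 4 - (b * c) * (b' * c'))
      by field.
    rewrite F1, F2, F3. field.
  - apply (Rmult_eq_reg_l 2); [field_simplify; cbn [pow]; nsatz | lra].
  - apply (Rmult_eq_reg_l 2); [field_simplify; cbn [pow]; nsatz | lra].
  - nsatz.
  - replace (- (b * c) + b' * c' + (a * b' - b * a') * (c * a' - a * c')) with
      (- (b * c) * (1 + a' * a') + b' * c' * (1 - a * a) + a * a' * (b * c' + b' * c)) by ring.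
    rewrite F1, F2, F3. ring.
  - nsatz.
Qed.

(** A one-sided inverse of a square matrix is two-sided: a frame that reproduces the inverse metric
    is orthonormal, and its timelike member has norm -1. *)
Lemma in_H2_of_dual_frame X0 X1 X2 : dual_frame X0 X1 X2 -> in_H2 X0.
Proof.
  unfold in_H2. rewrite !ip_coord.
  destruct X0 as [a b c], X1 as [a1 b1 c1], X2 as [a2 b2 c2].
  intros (H1 & H2 & H3 & H4 & H5 & H6); simpl in *.
  cut (a * a + b * c = -1); [lra|]. nsatz.
Qed.

(** Contracting the inverse metric with the covector [ip V] returns [V]; the minus sign is that of
    the timelike direction. *)
Lemma dual_frame_expand X0 X1 X2 V : dual_frame X0 X1 X2 ->
  V = sl2_add (sl2_scal (- ip V X0) X0)
        (sl2_add (sl2_scal (ip V X1) X1) (sl2_scal (ip V X2) X2)).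
Proof.
  rewrite !ip_coord.
  destruct X0 as [a b c], X1 as [a1 b1 c1], X2 as [a2 b2 c2], V as [u v w].
  intros (H1 & H2 & H3 & H4 & H5 & H6); simpl in *.
  apply sl2_ext; simpl.
  - pose proof (f_equal (Rmult u) H1). pose proof (f_equal (Rmult w) H2).
    pose proof (f_equal (Rmult v) H3). lra.
  - pose proof (f_equal (Rmult u) H2). pose proof (f_equal (Rmult w) H4).
    pose proof (f_equal (Rmult v) H5). lra.
  - pose proof (f_equal (Rmult u) H3). pose proof (f_equal (Rmult w) H5).
    pose proof (f_equal (Rmult v) H6). lra.
Qed.

(** * Derivatives of curves in sl(2,R), of inner products and of brackets *)

Definition sl2_is_derive (X : R -> sl2) (t : R) (V : sl2) : Prop :=
  is_derive (fun s => sl_a (X s)) t (sl_a V) /\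
  is_derive (fun s => sl_b (X s)) t (sl_b V) /\
  is_derive (fun s => sl_c (X s)) t (sl_c V).

(** The entries of a bracket and, after a change of sign, the inner product all have the shape
    [f g - h k], so one product rule serves for both. *)
Lemma is_derive_det (f g h k : R -> R) t f' g' h' k' :
  is_derive f t f' -> is_derive g t g' -> is_derive h t h' -> is_derive k t k' ->
  is_derive (fun s => f s * g s - h s * k s) t
    (f' * g t + f t * g' - (h' * k t + h t * k')).
Proof.
  intros F G H K.
  exact (is_derive_minus _ _ t _ _ (is_derive_mult f g t _ _ F G Rmult_comm)
    (is_derive_mult h k t _ _ H K Rmult_comm)).
Qed.

Lemma is_derive_div_2 (f : R -> R) t f' :
  is_derive f t f' -> is_derive (fun s => f s / 2) t (f' / 2).
Proof.
  intros F. apply (is_derive_ext (fun s => / 2 * f s)); [intros; apply Rmult_comm|].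
  unfold Rdiv. rewrite Rmult_comm. apply is_derive_scal, F.
Qed.

Lemma is_derive_ip X Y t V W :
  sl2_is_derive X t V -> sl2_is_derive Y t W ->
  is_derive (fun s => ip (X s) (Y s)) t (ip V (Y t) + ip (X t) W).
Proof.
  intros (X1 & X2 & X3) (Y1 & Y2 & Y3).
  (* The rule is used twice: the opposite of [sl_c] turns a difference into a sum, and the constant
     1 supplies the missing factor of the outer term. *)
  pose proof (is_derive_det _ _ _ _ t _ _ _ _ X2 Y3 (is_derive_opp _ _ _ X3) Y2) as D1.
  pose proof (is_derive_det _ _ _ _ t _ _ _ _ X1 Y1
    (is_derive_opp _ _ _ (is_derive_div_2 _ _ _ D1)) (is_derive_const 1 t)) as D2.
  unfold opp, zero in D2; simpl in D2.
  apply (is_derive_ext (fun s => sl_a (X s) * sl_a (Y s) -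
    - ((sl_b (X s) * sl_c (Y s) - - sl_c (X s) * sl_b (Y s)) / 2) * 1)).
  { intros s. rewrite ip_coord. match goal with |- ?u = ?v => change (@eq R u v) end. field. }
  match type of D2 with is_derive _ _ ?l => replace (ip V (Y t) + ip (X t) W) with l end;
    [exact D2|].
  rewrite !ip_coord. field.
Qed.

Lemma sl2_is_derive_half_bracket X Y t V W :
  sl2_is_derive X t V -> sl2_is_derive Y t W ->
  sl2_is_derive (fun s => half_bracket (X s) (Y s)) t
    (sl2_add (half_bracket V (Y t)) (half_bracket (X t) W)).
Proof.
  intros (X1 & X2 & X3) (Y1 & Y2 & Y3).
  pose proof (is_derive_div_2 _ _ _ (is_derive_det _ _ _ _ t _ _ _ _ X2 Y3 Y2 X3)) as D1.
  pose proof (is_derive_det _ _ _ _ t _ _ _ _ X1 Y2 X2 Y1) as D2.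
  pose proof (is_derive_det _ _ _ _ t _ _ _ _ X3 Y1 X1 Y3) as D3.
  unfold sl2_is_derive. simpl.
  refine (conj _ (conj _ _)).
  - match type of D1 with is_derive _ _ ?l => replace (_ + _) with l by field end. exact D1.
  - match type of D2 with is_derive _ _ ?l => replace (_ + _) with l by ring end. exact D2.
  - match type of D3 with is_derive _ _ ?l => replace (_ + _) with l by ring end. exact D3.
Qed.

(** * Functions of class C^k on the square *)

Section Square.

Variables lo hi : Rbar.

Local Notation I := (in_I lo hi).
Local Notation U := (in_IxI lo hi).

Local Notation cont_U f := (forall x y, U x y -> continuity_2d_pt f x y).
Local Notation Dx f fx := (forall x y, U x y -> is_derive (fun t => f t y) x (fx x y)).
Local Notation Dy f fy := (forall x y, U x y -> is_derive (fun t => f x t) y (fy x y)).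

Local Ltac split4 := refine (conj _ (conj _ (conj _ _))).

(* A function of one variable is handled as a function on the square that ignores the other variable. *)
Fixpoint Ck (k : nat) (f : R -> R -> R) : Prop :=
  cont_U f /\
  match k with
  | O => True
  | S k => exists fx fy, Dx f fx /\ Dy f fy /\ Ck k fx /\ Ck k fy
  end.

Lemma locally_I x : I x -> locally x I.
Proof.
  intros [H1 H2]. apply filter_and.
  - exact (open_Rbar_gt' x lo H1).
  - exact (open_Rbar_lt' x hi H2).
Qed.

Lemma locally_2d_U x y : U x y -> locally_2d U x y.
Proof.
  intros [[d1 H1]%locally_I [d2 H2]%locally_I].
  exists (mkposreal _ (Rmin_pos _ _ (cond_pos d1) (cond_pos d2))). simpl.
  intros u v Hu Hv. split.
  - apply H1. eapply Rlt_le_trans; [exact Hu | apply Rmin_l].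
  - apply H2. eapply Rlt_le_trans; [exact Hv | apply Rmin_r].
Qed.

Lemma I_between a b t : I a -> I b -> a <= t <= b -> I t.
Proof.
  intros [Ha _] [_ Hb] [H1 H2]. split.
  - exact (Rbar_lt_le_trans lo a t Ha H1).
  - exact (Rbar_le_lt_trans t b hi H2 Hb).
Qed.

Lemma I_convex a b t : I a -> I b -> Rmin a b <= t <= Rmax a b -> I t.
Proof.
  intros Ha Hb. apply Rmin_case; apply Rmax_case; apply I_between; auto.
Qed.

Lemma I_widen x : I x -> exists a b, I a /\ I b /\ a < x < b.
Proof.
  intros [d H]%locally_I. exists (x - d / 2), (x + d / 2).
  pose proof (cond_pos d). repeat split; try lra; apply H;
  unfold ball; simpl; unfold AbsRing_ball, abs, minus, plus, opp; simpl;
  apply Rabs_def1; lra.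
Qed.

Lemma Ck_cont k f : Ck k f -> cont_U f.
Proof. destruct k; intros [H _]; exact H. Qed.

Lemma Ck_S k f : Ck (S k) f -> Ck k f.
Proof.
  revert f. induction k; intros f [H H']; (split; [exact H|]); auto.
  destruct H' as (fx & fy & H1 & H2 & H3 & H4).
  exists fx, fy. split4; auto.
Qed.

Lemma Ck_ext k f g : (forall x y, U x y -> f x y = g x y) -> Ck k f -> Ck k g.
Proof.
  assert (Hc : (forall x y, U x y -> f x y = g x y) ->
cont_U f -> cont_U g).
  { intros E H x y Hu. apply (continuity_2d_pt_ext_loc f); auto.
    apply (locally_2d_impl (U)); [|apply locally_2d_U, Hu].
    apply locally_2d_forall. auto. }
  intros E. destruct k; intros [H H']; (split; [exact (Hc E H)|]); auto.
  destruct H' as (fx & fy & H1 & H2 & H3 & H4).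
  exists fx, fy. split4; auto.
  - intros x y [Hx Hy]. apply (is_derive_ext_loc (fun t => f t y));
      [| apply H1; split; auto].
    apply (filter_imp I); [|apply locally_I, Hx]. intros t Ht. apply E. split; auto.
  - intros x y [Hx Hy]. apply (is_derive_ext_loc (fun t => f x t));
      [| apply H2; split; auto].
    apply (filter_imp I); [|apply locally_I, Hy]. intros t Ht. apply E. split; auto.
Qed.

Lemma Ck_const k c : Ck k (fun _ _ => c).
Proof.
  revert c. induction k; intros c; (split; [intros; apply continuity_2d_pt_const|]); auto.
  exists (fun _ _ => 0), (fun _ _ => 0). split4; auto; intros x y Hu; exact (is_derive_const c _).
Qed.

Lemma Ck_plus k f g : Ck k f -> Ck k g -> Ck k (fun x y => f x y + g x y).
Proof.
  revert f g. induction k; intros f g [Hf Hf'] [Hg Hg'];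
  (split; [intros; apply continuity_2d_pt_plus; auto|]); auto.
  destruct Hf' as (fx & fy & F1 & F2 & F3 & F4), Hg' as (gx & gy & G1 & G2 & G3 & G4).
  exists (fun x y => fx x y + gx x y), (fun x y => fy x y + gy x y).
  split4; auto; intros x y Hu.
  - exact (is_derive_plus _ _ x _ _ (F1 x y Hu) (G1 x y Hu)).
  - exact (is_derive_plus _ _ y _ _ (F2 x y Hu) (G2 x y Hu)).
Qed.

Lemma Ck_mult k f g : Ck k f -> Ck k g -> Ck k (fun x y => f x y * g x y).
Proof.
  revert f g. induction k; intros f g Cf Cg;
  pose proof Cf as [Hf Hf']; pose proof Cg as [Hg Hg'];
  (split; [intros; apply continuity_2d_pt_mult; auto|]); auto.
  destruct Hf' as (fx & fy & F1 & F2 & F3 & F4), Hg' as (gx & gy & G1 & G2 & G3 & G4).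
  exists (fun x y => fx x y * g x y + f x y * gx x y),
         (fun x y => fy x y * g x y + f x y * gy x y).
  apply Ck_S in Cf, Cg.
  split4; try (apply Ck_plus; auto); intros x y Hu.
  - apply (is_derive_mult (fun t => f t y) (fun t => g t y)); auto. intros; apply Rmult_comm.
  - apply (is_derive_mult (fun t => f x t) (fun t => g x t)); auto. intros; apply Rmult_comm.
Qed.

Lemma Ck_opp k f : Ck k f -> Ck k (fun x y => - f x y).
Proof.
  intros H. apply (Ck_ext _ (fun x y => -1 * f x y)); [intros; ring|].
  apply Ck_mult; auto using Ck_const.
Qed.

Lemma Ck_minus k f g : Ck k f -> Ck k g -> Ck k (fun x y => f x y - g x y).
Proof. intros. apply Ck_plus; auto using Ck_opp. Qed.

(** Sine and cosine go through one induction because differentiation exchanges them. *)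
Lemma Ck_sin_cos k f :
  Ck k f -> Ck k (fun x y => sin (f x y)) /\ Ck k (fun x y => cos (f x y)).
Proof.
  revert f. induction k; intros f Cf; pose proof Cf as [Hf Hf'].
  - repeat split; intros; apply continuity_1d_2d_pt_comp; auto;
    [apply continuity_sin | apply continuity_cos].
  - destruct Hf' as (fx & fy & F1 & F2 & F3 & F4).
    destruct (IHk f (Ck_S _ _ Cf)) as [Cs Cc].
    split; split;
      try (intros; apply continuity_1d_2d_pt_comp; auto;
           [apply continuity_sin || apply continuity_cos]).
    + exists (fun x y => fx x y * cos (f x y)), (fun x y => fy x y * cos (f x y)).
      split4; try (apply Ck_mult; auto); intros x y Hu;
      apply (is_derive_comp sin); auto; apply is_derive_sin.
    + exists (fun x y => fx x y * - sin (f x y)), (fun x y => fy x y * - sin (f x y)).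
      split4; try (apply Ck_mult; auto using Ck_opp); intros x y Hu;
      apply (is_derive_comp cos); auto; apply is_derive_cos.
Qed.

Lemma continuity_2d_pt_flip f x y :
  continuity_2d_pt f x y -> continuity_2d_pt (fun u v => f v u) y x.
Proof.
  intros H eps. destruct (H eps) as [d Hd]. exists d. intros u v Hu Hv. apply Hd; auto.
Qed.

Lemma Ck_flip k f : Ck k f -> Ck k (fun x y => f y x).
Proof.
  assert (S : forall x y, U x y -> U y x) by (intros x y []; split; auto).
  revert f. induction k; intros f [Hf Hf'];
  (split; [intros x y Hu; apply (continuity_2d_pt_flip f); auto|]); auto.
  destruct Hf' as (fx & fy & F1 & F2 & F3 & F4).
  exists (fun x y => fy y x), (fun x y => fx y x).
  split4; auto.
Qed.

Lemma locally_U x y (P : R -> R -> Prop) :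
  U x y -> (forall u v, U u v -> P u v) -> locally_2d P x y.
Proof.
  intros Hu H. apply (locally_2d_impl U); [|apply locally_2d_U, Hu].
  apply locally_2d_forall. exact H.
Qed.

(** The chain rule along [t -> (t, t)] needs total differentiability, which follows from continuity
    of one partial derivative and existence of the other. *)
Lemma is_derive_diag f fx fy x :
  Dx f fx -> Dy f fy -> cont_U fx -> I x ->
  is_derive (fun t => f t t) x (fx x x + fy x x).
Proof.
  intros Fx Fy Cx Hx. assert (Hu : U x x) by (split; exact Hx).
  assert (H : filterdiff (fun u : R * R => f (fst u) (snd u)) (locally (x, x))
    (fun u : R * R => plus (scal (fst u) (fx x x)) (scal (snd u) (fy x x)))).
  { apply (is_derive_filterdiff f x x fx (fy x x)).
    - apply (locally_2d_locally (fun u v => is_derive (fun z => f z v) u (fx u v))).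
      apply locally_U; auto.
    - apply Fy, Hu.
    - apply continuity_2d_pt_filterlim. apply Cx, Hu. }
  unfold is_derive. eapply filterdiff_ext_lin.
  - apply (filterdiff_comp'_2 (fun t => t) (fun t => t) f x (fun t => t) (fun t => t)
      (fun u v => plus (scal u (fx x x)) (scal v (fy x x)))); auto using filterdiff_id.
  - intros z. simpl. unfold plus, scal, mult; simpl. unfold mult; simpl. ring.
Qed.

Lemma continuity_2d_pt_diag f x :
  continuity_2d_pt f x x -> forall y, continuity_2d_pt (fun u _ => f u u) x y.
Proof. intros H y eps. destruct (H eps) as [d Hd]. exists d. auto. Qed.

Lemma Ck_diag k f : Ck k f -> Ck k (fun x _ => f x x).
Proof.
  revert f. induction k; intros f Cf; pose proof Cf as [Hf Hf'];
  (split; [intros x y [Hx Hy]; apply (continuity_2d_pt_diag f); apply Hf; split; auto|]); auto.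
  destruct Hf' as (fx & fy & F1 & F2 & F3 & F4).
  exists (fun x _ => fx x x + fy x x), (fun _ _ => 0).
  split4; auto using Ck_const, Ck_plus.
  - intros x y [Hx Hy]. apply is_derive_diag; auto. apply Ck_cont with k, F3.
  - intros x y _. exact (is_derive_const (f x x) _).
Qed.

Lemma continuity_2d_pt_slice_y f x y :
  continuity_2d_pt f x y -> continuity_pt (fun t => f x t) y.
Proof.
  intros H. apply continuity_pt_filterlim, filterlim_locally. intros eps.
  destruct (H eps) as [d Hd]. exists d. intros t Ht. apply Hd; [|exact Ht].
  rewrite Rminus_diag, Rabs_R0. apply cond_pos.
Qed.

(** * Integration in one variable, starting from the diagonal *)

Definition vint (g : R -> R -> R) (x y : R) : R := RInt (fun s => g x s) x y.

Lemma cont_slice g x : cont_U g -> I x -> forall s, I s -> continuous (fun s => g x s) s.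
Proof.
  intros H Hx s Hs. apply continuity_pt_filterlim.
  apply continuity_2d_pt_slice_y, H. split; auto.
Qed.

Lemma ex_RInt_slice g x a b :
  cont_U g -> I x -> I a -> I b -> ex_RInt (fun s => g x s) a b.
Proof.
  intros H Hx Ha Hb. apply (ex_RInt_continuous (V:=R_CompleteNormedModule)).
  intros s Hs. apply cont_slice; auto. apply (I_convex a b); auto.
Qed.

Lemma Dy_vint g : cont_U g -> Dy (vint g) g.
Proof.
  intros H x y [Hx Hy]. apply (is_derive_RInt (fun s => g x s) _ x y).
  - apply (filter_imp I); [|apply locally_I, Hy].
    intros t Ht. apply (RInt_correct (V:=R_CompleteNormedModule)).
    apply ex_RInt_slice; auto.
  - apply cont_slice; auto.
Qed.

Lemma I_widen2 x y : I x -> I y -> exists a b, I a /\ I b /\ a < x < b /\ a < y < b.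
Proof.
  intros (a1 & b1 & Ha1 & Hb1 & H1)%I_widen (a2 & b2 & Ha2 & Hb2 & H2)%I_widen.
  exists (Rmin a1 a2), (Rmax b1 b2).
  pose proof (Rmin_l a1 a2). pose proof (Rmin_r a1 a2).
  pose proof (Rmax_l b1 b2). pose proof (Rmax_r b1 b2).
  assert (I (Rmin a1 a2)) by (apply Rmin_case; assumption).
  assert (I (Rmax b1 b2)) by (apply Rmax_case; assumption).
  split; [|split]; auto. lra.
Qed.

(** Leibniz rule: [x] is both a parameter of the integrand and the lower limit, and the moving limit
    contributes the diagonal value [- g x x]. *)
Lemma Dx_vint g gx : cont_U g -> Dx g gx -> cont_U gx ->
  Dx (vint g) (fun x y => vint gx x y - g x x).
Proof.
  intros C D Cx x y [Hx Hy].
  assert (E : forall u v, U u v -> Derive (fun z => g z v) u = gx u v).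
  { intros u v Hu. apply is_derive_unique, D, Hu. }
  assert (CE : forall u v, U u v ->
    continuity_2d_pt (fun u v => Derive (fun z => g z v) u) u v).
  { intros u v Hu. apply (continuity_2d_pt_ext_loc gx); [|apply Cx, Hu].
    apply locally_U; auto. intros; symmetry; auto. }
  destruct (locally_I x Hx) as [d Hd].
  pose proof (cond_pos d) as Pd.
  (* Half the radius keeps the closed interval around [x] inside the open one. *)
  set (e := mkposreal _ (is_pos_div_2 d)).
  assert (He : forall t, x - e <= t <= x + e -> I t).
  { intros t Ht. apply Hd. apply Rabs_def1; simpl in Ht;
    unfold minus, plus, opp; simpl; lra. }
  assert (HI : forall a b, I a -> I b ->
    locally x (fun z => ex_RInt (fun t => g z t) a b)).
  { intros a b Ha Hb. apply (filter_imp I); [|apply locally_I, Hx].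
    intros z Hz. apply ex_RInt_slice; auto. }
  replace (vint gx x y - g x x) with
    (RInt (fun t => Derive (fun u => g u t) x) x y + - g x x * 1).
  - apply (is_derive_RInt_param_bound_comp_aux2 g (fun z => z) y x 1).
    + auto.
    + exists e. apply HI; apply He; simpl; lra.
    + apply (is_derive_id x).
    + exists e. apply (filter_imp I); [|apply locally_I, Hx]. intros z Hz t Ht.
      exists (gx z t). apply D. split; auto.
      apply (I_between (Rmin (x - e) y) (Rmax (x + e) y)); auto;
      [apply Rmin_case | apply Rmax_case]; auto; apply He; simpl; lra.
    + intros t Ht. apply CE. split; auto. apply (I_convex x y); auto.
    + apply locally_U; auto. split; auto.
    + apply continuity_2d_pt_slice_y, C. split; auto.
  - unfold vint. rewrite (RInt_ext _ (fun s => gx x s)); [ring|].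
    intros t Ht. apply E. split; auto. apply (I_convex x y); auto. lra.
Qed.

Lemma cont_U_square g a b : cont_U g -> I a -> I b ->
  forall x y, a <= x <= b -> a <= y <= b -> continuity_2d_pt g x y.
Proof. intros C Ha Hb x y Hx Hy. apply C. split; apply (I_between a b); auto. Qed.

(* Walking diagonally from the corner in [n] steps shorter than the modulus of uniform continuity changes [g] by at most [n]. *)
Lemma bounded_square g a b : cont_U g -> I a -> I b ->
  exists M, 0 < M /\ forall x y, a <= x <= b -> a <= y <= b -> Rabs (g x y) <= M.
Proof.
  intros C Ha Hb.
  destruct (uniform_continuity_2d g a b a b (cont_U_square g a b C Ha Hb)
    (mkposreal 1 Rlt_0_1)) as [d Hd]. simpl in Hd.
  pose proof (cond_pos d) as Pd.
  assert (W : forall n x y, a <= x <= b -> a <= y <= b ->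
    x - a <= INR n * (d / 2) -> y - a <= INR n * (d / 2) ->
    Rabs (g x y - g a a) <= INR n).
  { induction n; intros x y Hx Hy Hxn Hyn.
    - simpl in Hxn, Hyn. replace x with a by lra. replace y with a by lra.
      rewrite Rminus_diag, Rabs_R0. simpl. lra.
    - rewrite S_INR in *.
      (* One step back towards the corner: retreat by [d / 2], or stop at [a] if that would leave
         the square. *)
      assert (Q : forall z, a <= z <= b -> z - a <= (INR n + 1) * (d / 2) ->
        exists z', a <= z' <= b /\ z' - a <= INR n * (d / 2) /\ Rabs (z - z') < d).
      { intros z Hz Hzn. pose proof (pos_INR n).
        assert (0 <= INR n * (d / 2)) by (apply Rmult_le_pos; lra).
        destruct (Rle_dec (z - d / 2) a).
        - exists a. repeat split; try lra. rewrite Rabs_pos_eq; lra.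
        - exists (z - d / 2). repeat split; try lra. rewrite Rabs_pos_eq; lra. }
      destruct (Q x Hx Hxn) as (x' & Hx' & Hxn' & Dx').
      destruct (Q y Hy Hyn) as (y' & Hy' & Hyn' & Dy').
      specialize (IHn x' y' Hx' Hy' Hxn' Hyn').
      specialize (Hd x' y' x y Hx' Hy' Hx Hy Dx' Dy').
      replace (g x y - g a a) with ((g x y - g x' y') + (g x' y' - g a a)) by ring.
      eapply Rle_trans; [apply Rabs_triang|]. lra. }
  destruct (INR_unbounded ((b - a) / (d / 2))) as [n Hn].
  assert (Hn' : b - a <= INR n * (d / 2)).
  { apply Rlt_le. apply (Rmult_lt_compat_r (d / 2)) in Hn; [|lra].
    unfold Rdiv at 1 in Hn. rewrite Rmult_assoc, Rinv_l, Rmult_1_r in Hn; lra. }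
  exists (Rabs (g a a) + INR n + 1). pose proof (pos_INR n). pose proof (Rabs_pos (g a a)).
  split; [lra|]. intros x y Hx Hy.
  assert (Rabs (g x y - g a a) <= INR n) by (apply W; auto; lra).
  replace (g x y) with ((g x y - g a a) + g a a) by ring.
  eapply Rle_trans; [apply Rabs_triang|]. lra.
Qed.
Lemma abs_RInt_le_const_any (f : R -> R) a b M :
  ex_RInt f a b -> (forall t, Rmin a b <= t <= Rmax a b -> Rabs (f t) <= M) ->
  Rabs (RInt f a b) <= M * Rabs (b - a).
Proof.
  destruct (Rle_dec a b) as [H|H]; intros E B.
  - rewrite Rmin_left, Rmax_right in B by lra.
    rewrite (Rabs_pos_eq (b - a)), Rmult_comm by lra.
    apply abs_RInt_le_const; auto.
  - rewrite Rmin_right, Rmax_left in B by lra.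
    rewrite <- (opp_RInt_swap (V:=R_CompleteNormedModule)) by apply ex_RInt_swap, E.
    unfold opp; simpl. rewrite Rabs_Ropp, Rabs_minus_sym.
    rewrite (Rabs_pos_eq (a - b)), Rmult_comm by lra.
    apply abs_RInt_le_const; auto; try lra. apply ex_RInt_swap, E.
Qed.

Lemma common_radius a b : 0 < a -> 0 < b -> exists r, 0 < r /\ (r <= a /\ r <= b).
Proof.
  intros Ha Hb. exists (Rmin a b).
  split; [apply Rmin_pos; auto | split; [apply Rmin_l | apply Rmin_r]].
Qed.

(** Splitting the integral from [u] to [v] at [x] and [y] leaves two short end pieces, controlled by
    a bound on [g], and a middle piece where [g u] is compared with [g x] by uniform continuity. *)
Lemma cont_vint g : cont_U g -> cont_U (vint g).
Proof.
  intros C x y [Hx Hy] eps.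
  destruct (I_widen2 x y Hx Hy) as (a & b & Ha & Hb & Hxab & Hyab).
  destruct (bounded_square g a b C Ha Hb) as (M & PM & HM).
  pose proof (cond_pos eps) as Pe.
  pose proof (Rabs_pos (y - x)) as Pxy.
  (* The 1 in the denominator keeps the tolerance meaningful on the diagonal, where the middle
     interval has length zero. *)
  assert (Pe1 : 0 < eps / 3 / (1 + Rabs (y - x))) by (apply Rdiv_lt_0_compat; lra).
  destruct (uniform_continuity_2d g a b a b (cont_U_square g a b C Ha Hb)
    (mkposreal _ Pe1)) as [d Hd]. simpl in Hd.
  pose proof (cond_pos d) as Pd.
  assert (Pe2 : 0 < eps / 3 / M) by (apply Rdiv_lt_0_compat; lra).
  assert (Hr : exists r, 0 < r /\
    (r <= d /\ r <= eps / 3 / M) /\ (r <= x - a /\ r <= b - x) /\ r <= y - a /\ r <= b - y).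
  { destruct (common_radius d (eps / 3 / M)) as (r1 & P1 & H1); auto.
    destruct (common_radius (x - a) (b - x)) as (r2 & P2 & H2); try lra.
    destruct (common_radius (y - a) (b - y)) as (r3 & P3 & H3); try lra.
    destruct (common_radius r1 r2) as (r4 & P4 & H4); auto.
    destruct (common_radius r3 r4) as (r & P & H); auto.
    exists r. lra. }
  destruct Hr as (r & Pr & Hr).
  exists (mkposreal r Pr). simpl. intros u v Hu Hv.
  apply Rabs_def2 in Hu, Hv.
  assert (Hua : a <= u <= b) by lra. assert (Hva : a <= v <= b) by lra.
  assert (Iu : I u) by (apply (I_between a b); auto).
  assert (Iv : I v) by (apply (I_between a b); auto).
  unfold vint.
  rewrite <- (RInt_Chasles (V:=R_CompleteNormedModule) (fun s => g u s) u x v)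
    by (apply ex_RInt_slice; auto).
  rewrite <- (RInt_Chasles (V:=R_CompleteNormedModule) (fun s => g u s) x y v)
    by (apply ex_RInt_slice; auto).
  unfold plus; simpl.
  assert (B1 : Rabs (RInt (fun s => g u s) u x) <= M * Rabs (x - u)).
  { apply abs_RInt_le_const_any; [apply ex_RInt_slice; auto|].
    intros t Ht. apply HM; auto. revert Ht. apply Rmin_case; apply Rmax_case; lra. }
  assert (B2 : Rabs (RInt (fun s => g u s) y v) <= M * Rabs (v - y)).
  { apply abs_RInt_le_const_any; [apply ex_RInt_slice; auto|].
    intros t Ht. apply HM; auto. revert Ht. apply Rmin_case; apply Rmax_case; lra. }
  assert (B3 : Rabs (RInt (fun s => g u s - g x s) x y)
    <= eps / 3 / (1 + Rabs (y - x)) * Rabs (y - x)).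
  { apply abs_RInt_le_const_any.
    - apply (ex_RInt_minus (V:=R_CompleteNormedModule)); apply ex_RInt_slice; auto.
    - intros t Ht.
      assert (a <= t <= b) by (revert Ht; apply Rmin_case; apply Rmax_case; lra).
      apply Rlt_le, Hd; try lra; [apply Rabs_def1; lra|].
      rewrite Rminus_diag, Rabs_R0. lra. }
  rewrite (RInt_minus (V:=R_CompleteNormedModule) (fun s => g u s) (fun s => g x s)) in B3
    by (apply ex_RInt_slice; auto).
  unfold minus, plus, opp in B3; simpl in B3.
  set (I1 := RInt (fun s => g u s) u x) in *. set (I2 := RInt (fun s => g u s) y v) in *.
  set (I3 := RInt (fun s => g u s) x y) in *. set (I4 := RInt (fun s => g x s) x y) in *.
  assert (K3 : eps / 3 / (1 + Rabs (y - x)) * Rabs (y - x) <= eps / 3).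
  { rewrite <- (Rmult_1_r (eps / 3)) at 2. unfold Rdiv at 1. rewrite Rmult_assoc.
    apply Rmult_le_compat_l; [lra|]. rewrite Rmult_comm. apply Rle_div_l; lra. }
  assert (K : forall z, z < r -> M * z < eps / 3).
  { intros z Hz. apply Rlt_le_trans with (M * (eps / 3 / M)).
    - apply Rmult_lt_compat_l; lra.
    - right. field. lra. }
  assert (K1 : M * Rabs (x - u) < eps / 3) by (apply K, Rabs_def1; lra).
  assert (K2 : M * Rabs (v - y) < eps / 3) by (apply K, Rabs_def1; lra).
  replace (I1 + (I3 + I2) - I4) with (I1 + ((I3 + - I4) + I2)) by ring.
  eapply Rle_lt_trans; [apply Rabs_triang|].
  assert (Rabs (I3 + - I4 + I2) <= Rabs (I3 + - I4) + Rabs I2) by apply Rabs_triang.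
  lra.
Qed.

Lemma Ck_vint k g : Ck k g -> Ck k (vint g).
Proof.
  revert g. induction k; intros g Cg; pose proof Cg as [Hg Hg'];
  (split; [apply cont_vint; exact Hg|]); auto.
  destruct Hg' as (gx & gy & G1 & G2 & G3 & G4).
  exists (fun x y => vint gx x y - g x x), g. split4.
  - apply Dx_vint; auto. apply Ck_cont with k, G3.
  - apply Dy_vint; auto.
  - apply Ck_minus; auto. apply Ck_diag, Ck_S, Cg.
  - apply Ck_S, Cg.
Qed.

(** * Growth bounds with exponential weights *)

(** The comparison function [C / k * exp (k * (s - y)) - f s] has nonnegative derivative and starts
    at [C / k >= 0], so the mean value theorem keeps it nonnegative. *)
Lemma exp_growth_right (f f' : R -> R) x y C k :
  0 < k -> 0 <= C -> y <= x -> f y = 0 ->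
  (forall s, y <= s <= x -> is_derive f s (f' s)) ->
  (forall s, y <= s <= x -> f' s <= C * exp (k * (s - y))) ->
  f x <= C / k * exp (k * (x - y)).
Proof.
  intros Hk HC Hxy Hy HD HB.
  set (g := fun s => C / k * exp (k * (s - y)) - f s).
  assert (Dg : forall s, y <= s <= x -> is_derive g s (C * exp (k * (s - y)) - f' s)).
  { intros s Hs. apply (is_derive_minus (fun s => C / k * exp (k * (s - y))) f); [|auto].
    auto_derive; [auto|]. unfold Rminus. field. lra. }
  destruct (MVT_gen g y x (fun s => C * exp (k * (s - y)) - f' s)) as (c & Hc & E).
  - rewrite Rmin_left, Rmax_right by lra. intros s Hs. apply Dg. lra.
  - rewrite Rmin_left, Rmax_right by lra. intros s Hs.
    apply continuity_pt_filterlim. apply (ex_derive_continuous g). eexists. apply Dg; auto.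
  - rewrite Rmin_left, Rmax_right in Hc by lra.
    unfold g in E at 1 2. rewrite Hy in E.
    replace (k * (y - y)) with 0 in E by ring. rewrite exp_0 in E.
    specialize (HB c Hc).
    assert (0 <= C / k) by (apply Rdiv_le_0_compat; lra).
    assert (0 <= (C * exp (k * (c - y)) - f' c) * (x - y)) by (apply Rmult_le_pos; lra).
    lra.
Qed.

(** One integration gains a factor [1 / k] in the weighted norm. The two-sided bound comes from the
    one-sided one applied to [f] and [- f], after the reflection [t -> - t] when [x] lies left of
    [y]. *)
Lemma exp_growth (f f' : R -> R) x y C k :
  0 < k -> 0 <= C -> f y = 0 ->
  (forall s, Rmin x y <= s <= Rmax x y -> is_derive f s (f' s)) ->
  (forall s, Rmin x y <= s <= Rmax x y -> Rabs (f' s) <= C * exp (k * Rabs (s - y))) ->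
  Rabs (f x) <= C / k * exp (k * Rabs (x - y)).
Proof.
  intros Hk HC Hy HD HB. destruct (Rle_dec y x) as [H|H].
  - rewrite Rmin_right, Rmax_left in HD, HB by lra.
    rewrite (Rabs_pos_eq (x - y)) by lra.
    assert (HB' : forall s, y <= s <= x -> Rabs (f' s) <= C * exp (k * (s - y))).
    { intros s Hs. rewrite <- (Rabs_pos_eq (s - y)) by lra. auto. }
    apply Rabs_le. split.
    + cut (- f x <= C / k * exp (k * (x - y))); [lra|].
      apply (exp_growth_right (fun s => - f s) (fun s => - f' s)); auto; [lra| |].
      * intros s Hs. apply (is_derive_opp f); auto.
      * intros s Hs. eapply Rle_trans; [|apply HB', Hs]. rewrite <- Rabs_Ropp. apply Rle_abs.
    + apply (exp_growth_right f f'); auto.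
      intros s Hs. eapply Rle_trans; [|apply HB', Hs]. apply Rle_abs.
  - rewrite Rmin_left, Rmax_right in HD, HB by lra.
    rewrite Rabs_minus_sym, (Rabs_pos_eq (y - x)) by lra.
    assert (HB' : forall s, x <= s <= y -> Rabs (f' s) <= C * exp (k * (y - s))).
    { intros s Hs. rewrite <- (Rabs_pos_eq (y - s)), Rabs_minus_sym by lra. auto. }
    assert (HD' : forall s, - y <= s <= - x -> is_derive (fun t => f (- t)) s (- f' (- s))).
    { intros s Hs. replace (- f' (- s)) with (scal (-1) (f' (- s)))
        by (unfold scal; simpl; unfold mult; simpl; ring).
      apply (is_derive_comp f Ropp); [apply HD; lra|]. auto_derive; auto. }
    apply Rabs_le. replace (y - x) with (- x - - y) by ring.
    replace (f x) with (f (- - x)) by (f_equal; ring). split.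
    + cut (- f (- - x) <= C / k * exp (k * (- x - - y))); [lra|].
      apply (exp_growth_right (fun s => - f (- s)) (fun s => - - f' (- s)));
        auto; [lra|rewrite Ropp_involutive; lra| |].
      * intros s Hs. apply (is_derive_opp (fun t => f (- t))); auto.
      * intros s Hs. replace (s - - y) with (y - - s) by ring.
        eapply Rle_trans; [|apply HB'; lra]. rewrite Ropp_involutive. apply Rle_abs.
    + apply (exp_growth_right (fun s => f (- s)) (fun s => - f' (- s)));
        auto; [lra|rewrite Ropp_involutive; lra|].
      intros s Hs. replace (s - - y) with (y - - s) by ring.
      eapply Rle_trans; [|apply HB'; lra]. rewrite <- Rabs_Ropp. apply Rle_abs.
Qed.

(** * The double integral that inverts the mixed derivative *)

(** Up to sign the integral of [g] over the triangle between the diagonal and [(x, y)]: the solution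
    of [u_xy = g] for which [u] and [u_x] vanish on the diagonal. *)
Definition dint (g : R -> R -> R) (x y : R) : R := vint (fun a s => vint g s a) y x.

Lemma cont_flip g : cont_U g -> cont_U (fun x y => g y x).
Proof.
  intros C x y [Hx Hy]. apply (continuity_2d_pt_flip g), C. split; auto.
Qed.

Lemma cont_flip_vint g : cont_U g -> cont_U (fun a s => vint g s a).
Proof. intros C. apply (cont_flip (vint g)), cont_vint, C. Qed.

Lemma Dx_dint g : cont_U g -> Dx (dint g) (vint g).
Proof.
  intros C x y [Hx Hy].
  apply (Dy_vint (fun a s => vint g s a) (cont_flip_vint g C) y x). split; auto.
Qed.

Lemma Dy_dint g : cont_U g -> Dy (dint g) (fun x y => vint (fun a s => g s a) y x).
Proof.
  intros C x y [Hx Hy].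
  (* The subtracted term is an integral over a point; it is the diagonal contribution in the Leibniz
     rule of [Dx_vint]. *)
  assert (E : vint (fun a s => g s a) y x =
    vint (fun a s => g s a) y x - vint g y y).
  { unfold vint at 3. rewrite RInt_point. unfold zero; simpl. ring. }
  rewrite E.
  apply (Dx_vint (fun a s => vint g s a) (fun a s => g s a)).
  - apply cont_flip_vint, C.
  - intros u v [Hu Hv]. apply (Dy_vint g C v u). split; auto.
  - apply cont_flip, C.
  - split; auto.
Qed.

(** Both first partials are single integrals of [g], hence as regular as [g]. This gain of one
    derivative drives the regularity bootstrap below. *)
Lemma Ck_S_dint k g : Ck k g -> Ck (S k) (dint g).
Proof.
  intros C. pose proof (Ck_cont k g C) as C0. split.
  - apply (cont_flip (vint (fun a s => vint g s a))).
    apply cont_vint, cont_flip_vint, C0.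
  - exists (vint g), (fun x y => vint (fun a s => g s a) y x). split4.
    + apply Dx_dint, C0.
    + apply Dy_dint, C0.
    + apply Ck_vint, C.
    + apply (Ck_flip k (vint (fun a s => g s a))), Ck_vint, (Ck_flip k g), C.
Qed.

Lemma between_square a b x y s :
  a <= x <= b -> a <= y <= b -> Rmin x y <= s <= Rmax x y -> a <= s <= b.
Proof. intros Hx Hy. apply Rmin_case; apply Rmax_case; lra. Qed.

(** Two integrations starting on the diagonal, each gaining [1 / k]. For large [k] this makes a
    Lipschitz nonlinearity followed by [dint] a contraction on all of a compact square, however
    large. *)
Lemma dint_growth g1 g2 a b k M :
  cont_U g1 -> cont_U g2 -> I a -> I b -> 0 < k -> 0 <= M ->
  (forall x y, a <= x <= b -> a <= y <= b ->
    Rabs (g1 x y - g2 x y) <= M * exp (k * Rabs (x - y))) ->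
  forall x y, a <= x <= b -> a <= y <= b ->
    Rabs (dint g1 x y - dint g2 x y) <= M / k / k * exp (k * Rabs (x - y)).
Proof.
  intros C1 C2 Ha Hb Hk HM HB x y Hx Hy.
  assert (HU : forall u v, a <= u <= b -> a <= v <= b -> U u v).
  { intros u v Hu Hv. split; apply (I_between a b); auto. }
  assert (P : 0 <= M / k) by (apply Rdiv_le_0_compat; lra).
  apply (exp_growth (fun s => dint g1 s y - dint g2 s y)
    (fun s => vint g1 s y - vint g2 s y)); auto.
  - unfold dint, vint at 1 3. rewrite !RInt_point. unfold zero; simpl. ring.
  - intros s Hs. assert (a <= s <= b) by (apply (between_square a b x y); auto).
    apply (is_derive_minus (fun s => dint g1 s y) (fun s => dint g2 s y));
    apply Dx_dint; auto.
  - intros s Hs. assert (Hs' : a <= s <= b) by (apply (between_square a b x y); auto).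
    (* The inner integral runs from the diagonal point [(s, s)] to [(s, y)]. *)
    rewrite (Rabs_minus_sym s y).
    apply (exp_growth (fun t => vint g1 s t - vint g2 s t) (fun t => g1 s t - g2 s t)); auto.
    + unfold vint. rewrite !RInt_point. unfold zero; simpl. ring.
    + intros t Ht. assert (a <= t <= b) by (apply (between_square a b y s); auto).
      apply (is_derive_minus (fun t => vint g1 s t) (fun t => vint g2 s t));
      apply Dy_vint; auto.
    + intros t Ht. rewrite (Rabs_minus_sym t s). apply HB; auto.
      apply (between_square a b y s); auto.
Qed.

(** * Picard iteration for the Cauchy problem on the diagonal *)

Lemma exp_monotone x y : x <= y -> exp x <= exp y.
Proof. intros [H|H]; [apply Rlt_le, exp_increasing, H | right; f_equal; exact H]. Qed.

Lemma half_pow_small C eps : 0 < eps -> exists n, C * (1 / 2) ^ n < eps.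
Proof.
  intros He. destruct (Rle_dec C 0) as [H|H].
  - exists O. simpl. lra.
  - destruct (pow_lt_1_zero (1 / 2)) with (y := eps / C) as [n Hn].
    + rewrite Rabs_pos_eq; lra.
    + apply Rdiv_lt_0_compat; lra.
    + exists n. specialize (Hn n (Nat.le_refl n)).
      rewrite Rabs_pos_eq in Hn by (apply pow_le; lra).
      apply (Rmult_lt_compat_l C) in Hn; [|lra].
      replace (C * (eps / C)) with eps in Hn by (field; lra). exact Hn.
Qed.

Lemma eq_0_of_half_pow C x : (forall n, Rabs x <= C * (1 / 2) ^ n) -> x = 0.
Proof.
  intros H. destruct (Req_dec x 0) as [E|E]; [exact E|]. exfalso.
  destruct (half_pow_small C (Rabs x) (Rabs_pos_lt x E)) as [n Hn].
  specialize (H n). lra.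
Qed.

Lemma geometric_cauchy (w : nat -> R) E :
  (forall n, Rabs (w (S n) - w n) <= E * (1 / 2) ^ n) ->
  is_lim_seq w (real (Lim_seq w)) /\
  forall n, Rabs (real (Lim_seq w) - w n) <= 2 * E * (1 / 2) ^ n.
Proof.
  intros H.
  assert (PE : 0 <= E) by (specialize (H O); pose proof (Rabs_pos (w 1%nat - w O)); simpl in H; lra).
  (* The factor [1 - (1 / 2) ^ m] is the exact partial geometric sum; with it the induction on [m]
     closes. *)
  assert (D : forall n m, Rabs (w (n + m)%nat - w n) <= 2 * E * (1 / 2) ^ n * (1 - (1 / 2) ^ m)).
  { intros n. induction m.
    - rewrite Nat.add_0_r, Rminus_diag, Rabs_R0. simpl. lra.
    - rewrite Nat.add_succ_r.
      replace (w (S (n + m)) - w n) with ((w (S (n + m)) - w (n + m)%nat) + (w (n + m)%nat - w n)) by ring.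
      eapply Rle_trans; [apply Rabs_triang|].
      specialize (H (n + m)%nat). rewrite pow_add in H. simpl. lra. }
  assert (D' : forall n m, Rabs (w (n + m)%nat - w n) <= 2 * E * (1 / 2) ^ n).
  { intros n m. eapply Rle_trans; [apply D|].
    assert (0 <= (1 / 2) ^ m) by (apply pow_le; lra).
    assert (0 <= (1 / 2) ^ n) by (apply pow_le; lra).
    assert (0 <= E * (1 / 2) ^ n * (1 / 2) ^ m)
      by (repeat apply Rmult_le_pos; auto). lra. }
  assert (L : is_lim_seq w (real (Lim_seq w))).
  { apply Lim_seq_correct', ex_lim_seq_cauchy_corr. intros eps.
    destruct (half_pow_small (4 * E) eps (cond_pos eps)) as [N HN]. exists N.
    intros n m Hn Hm.
    replace n with (N + (n - N))%nat by lia. replace m with (N + (m - N))%nat by lia.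
    pose proof (D' N (n - N)%nat) as D1. pose proof (D' N (m - N)%nat) as D2.
    rewrite Rabs_minus_sym in D2.
    replace (w (N + (n - N))%nat - w (N + (m - N))%nat) with
      ((w (N + (n - N))%nat - w N) + (w N - w (N + (m - N))%nat)) by ring.
    eapply Rle_lt_trans; [apply Rabs_triang|]. lra. }
  split; [exact L|]. intros n.
  (* The tail bound is uniform in [m], so it passes to the limit. *)
  apply (is_lim_seq_le (fun m => Rabs (w (n + m)%nat - w n)) (fun _ => 2 * E * (1 / 2) ^ n)
    (Rabs (real (Lim_seq w) - w n)) (2 * E * (1 / 2) ^ n)); [apply D'| |apply is_lim_seq_const].
  apply (is_lim_seq_abs _ (real (Lim_seq w) - w n)).
  apply is_lim_seq_minus'; [|apply is_lim_seq_const].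
  apply (is_lim_seq_ext (fun m => w (m + n)%nat)); [intros; f_equal; lia|].
  apply (is_lim_seq_incr_n w n), L.
Qed.

Lemma cont_uniform_limit (w : nat -> R -> R -> R) (u : R -> R -> R) :
  (forall n, cont_U (w n)) ->
  (forall a b, I a -> I b -> exists E, forall n x y, a <= x <= b -> a <= y <= b ->
     Rabs (u x y - w n x y) <= E * (1 / 2) ^ n) ->
  cont_U u.
Proof.
  intros Cw Cv x y [Hx Hy] eps.
  destruct (I_widen2 x y Hx Hy) as (a & b & Ha & Hb & Hxab & Hyab).
  destruct (Cv a b Ha Hb) as [E HE].
  pose proof (cond_pos eps) as Pe.
  destruct (half_pow_small E (eps / 3)) as [n Hn]; [lra|].
  destruct (Cw n x y (conj Hx Hy) (mkposreal (eps / 3) ltac:(lra))) as [d Hd]. simpl in Hd.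
  destruct (common_radius (x - a) (b - x)) as (r2 & P2 & H2); try lra.
  destruct (common_radius (y - a) (b - y)) as (r3 & P3 & H3); try lra.
  destruct (common_radius r2 r3) as (r4 & P4 & H4); auto.
  destruct (common_radius d r4) as (r & P & H); auto using cond_pos.
  exists (mkposreal r P). simpl. intros s t Hs Ht.
  assert (Q : Rabs (w n s t - w n x y) < eps / 3) by (apply Hd; lra).
  apply Rabs_def2 in Hs, Ht.
  assert (Q1 : Rabs (u s t - w n s t) <= E * (1 / 2) ^ n) by (apply HE; lra).
  assert (Q2 : Rabs (u x y - w n x y) <= E * (1 / 2) ^ n) by (apply HE; lra).
  rewrite Rabs_minus_sym in Q2.
  replace (u s t - u x y) with ((u s t - w n s t) + ((w n s t - w n x y) + (w n x y - u x y))) by ring.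
  eapply Rle_lt_trans; [apply Rabs_triang|].
  pose proof (Rabs_triang (w n s t - w n x y) (w n x y - u x y)). lra.
Qed.

(** The equation is [u_xy = G (x, y, u)] with [u] and [u_x] prescribed on the diagonal. A Lipschitz
    constant valid for all values of [u] on each compact square rules out blow-up, so the solution
    is global; the first hypothesis lets regularity pass through [G]. *)
Lemma semilinear_cauchy_problem (G : R -> R -> R -> R) (u0 u1 : R -> R) :
  (forall k v, Ck k v -> Ck k (fun x y => G x y (v x y))) ->
  (forall a b, I a -> I b -> exists L, 0 < L /\
     forall x y u v, a <= x <= b -> a <= y <= b ->
       Rabs (G x y u - G x y v) <= L * Rabs (u - v)) ->
  (forall k, Ck k (fun x _ => u0 x)) -> (forall k, Ck k (fun x _ => u1 x)) ->
  exists u ux : R -> R -> R,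
    (forall k, Ck k u) /\ (forall k, Ck k ux) /\
    Dx u ux /\ Dy ux (fun x y => G x y (u x y)) /\
    forall t, I t -> u t t = u0 t /\ ux t t = u1 t.
Proof.
  intros HG HL H0 H1.
  (* [h] solves the homogeneous equation [h_xy = 0] with the given Cauchy data, so solutions are the
     fixed points of [T]. *)
  set (h := fun x y => u0 y + vint (fun _ s => u1 s) y x).
  set (T := fun v x y => h x y + dint (fun x y => G x y (v x y)) x y).
  assert (H1' : forall k, Ck k (fun _ s => u1 s)).
  { intros k. apply (Ck_flip k (fun x _ => u1 x)), H1. }
  assert (Hh : forall k, Ck k h).
  { intros k. apply Ck_plus.
    - apply (Ck_flip k (fun x _ => u0 x)), H0.
    - apply (Ck_flip k (vint (fun _ s => u1 s))), Ck_vint, H1'. }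
  assert (HG0 : forall v, cont_U v -> cont_U (fun x y => G x y (v x y))).
  { intros v Cv. apply (Ck_cont 0), HG. split; auto. }
  assert (HT : forall k v, Ck k v -> Ck (S k) (T v)).
  { intros k v Cv. apply Ck_plus; [apply Hh|]. apply Ck_S_dint, HG, Cv. }
  set (w := fix w n := match n with O => h | S n => T (w n) end).
  assert (Cw : forall n, cont_U (w n)).
  { intros n. apply (Ck_cont 0). induction n; [apply Hh|]. apply Ck_S, HT, IHn. }
  set (u := fun x y => real (Lim_seq (fun n => w n x y))).
  assert (B : forall a b, I a -> I b -> exists L k E, 0 < L /\ 0 < k /\ 0 <= E /\
    (forall x y u v, a <= x <= b -> a <= y <= b ->
       Rabs (G x y u - G x y v) <= L * Rabs (u - v)) /\
    forall n x y, a <= x <= b -> a <= y <= b ->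
      Rabs (u x y - w n x y) <= E * (1 / 2) ^ n).
  { intros a b Ha Hb. destruct (HL a b Ha Hb) as (L & PL & HLip).
    (* With this weight [k * k >= 2 * L], so one iteration contracts by 1/2. *)
    set (k := 1 + 2 * L). assert (Pk : 0 < k) by (unfold k; lra).
    assert (Hk : L / k / k <= 1 / 2).
    { replace (L / k / k) with (L / (k * k)) by (field; lra).
      apply Rle_div_l; [apply Rmult_lt_0_compat; lra|]. unfold k.
      pose proof (Rmult_lt_0_compat L L PL PL). lra. }
    destruct (bounded_square (fun x y => w 1%nat x y + -1 * w O x y) a b) as (M & PM & HM); auto.
    { intros x y Hu. apply continuity_2d_pt_plus; [apply Cw, Hu|].
      apply continuity_2d_pt_mult; [apply continuity_2d_pt_const|apply Cw, Hu]. }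
    assert (W : forall n x y, a <= x <= b -> a <= y <= b ->
      Rabs (w (S n) x y - w n x y) <= M * (1 / 2) ^ n * exp (k * Rabs (x - y))).
    { induction n; intros x y Hx Hy.
      - replace (w 1%nat x y - w O x y) with (w 1%nat x y + -1 * w O x y) by ring.
        eapply Rle_trans; [apply HM; auto|]. rewrite pow_O, Rmult_1_r.
        rewrite <- (Rmult_1_r M) at 1. apply Rmult_le_compat_l; [lra|].
        rewrite <- exp_0 at 1. apply exp_monotone.
        apply Rmult_le_pos; [lra|apply Rabs_pos].
      - replace (w (S (S n)) x y - w (S n) x y) with
          (dint (fun x y => G x y (w (S n) x y)) x y - dint (fun x y => G x y (w n x y)) x y)
          by (simpl; unfold T; ring).
        assert (Pn : 0 <= (1 / 2) ^ n) by (apply pow_le; lra).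
        eapply Rle_trans.
        + apply (dint_growth _ _ a b k (L * (M * (1 / 2) ^ n))); auto.
          * repeat apply Rmult_le_pos; lra.
          * intros s t Hs Ht. eapply Rle_trans; [apply HLip; auto|].
            rewrite Rmult_assoc. apply Rmult_le_compat_l; [lra|]. apply IHn; auto.
        + apply Rmult_le_compat_r; [apply Rlt_le, exp_pos|].
          replace (L * (M * (1 / 2) ^ n) / k / k) with ((L / k / k) * (M * (1 / 2) ^ n))
            by (field; lra).
          replace (M * (1 / 2) ^ S n) with (1 / 2 * (M * (1 / 2) ^ n)) by (simpl; ring).
          apply Rmult_le_compat_r; auto. apply Rmult_le_pos; lra. }
    (* The weight is at most [exp (k * (b - a))] on the square, and summing the geometric tail
       doubles the constant. *)
    exists L, k, (2 * (M * exp (k * (b - a)))).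
    assert (P : 0 <= M * exp (k * (b - a))) by (apply Rmult_le_pos; [lra|apply Rlt_le, exp_pos]).
    split; [lra|split; [lra|split; [lra|split; [exact HLip|]]]].
    intros n x y Hx Hy. apply (geometric_cauchy (fun n => w n x y)).
    intros m. eapply Rle_trans; [apply W; auto|].
    assert (0 <= M * (1 / 2) ^ m) by (apply Rmult_le_pos; [lra|apply pow_le; lra]).
    replace (M * exp (k * (b - a)) * (1 / 2) ^ m) with (M * (1 / 2) ^ m * exp (k * (b - a))) by ring.
    apply Rmult_le_compat_l; auto. apply exp_monotone.
    apply Rmult_le_compat_l; [lra|]. apply Rabs_le. lra. }
  assert (Cu : cont_U u).
  { apply (cont_uniform_limit w); auto. intros a b Ha Hb.
    destruct (B a b Ha Hb) as (L & k & E & _ & _ & _ & _ & HE). exists E. exact HE. }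
  assert (Fix : forall x y, U x y -> u x y = T u x y).
  { intros x y [Hx Hy]. destruct (I_widen2 x y Hx Hy) as (a & b & Ha & Hb & Hxab & Hyab).
    destruct (B a b Ha Hb) as (L & k & E & PL & Pk & PE & HLip & HE).
    apply Rminus_diag_uniq.
    (* Split [u - T u] as [(u - w (S n)) + (T (w n) - T u)]; both terms decay like [(1 / 2) ^ n]. *)
    apply (eq_0_of_half_pow (E + L * E / k / k * exp (k * Rabs (x - y)))). intros n.
    assert (Pn : 0 <= (1 / 2) ^ n) by (apply pow_le; lra).
    assert (Q1 : Rabs (u x y - w (S n) x y) <= E * (1 / 2) ^ S n) by (apply HE; lra).
    assert (Q2 : Rabs (dint (fun x y => G x y (w n x y)) x y - dint (fun x y => G x y (u x y)) x y)
      <= L * (E * (1 / 2) ^ n) / k / k * exp (k * Rabs (x - y))).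
    { apply (dint_growth _ _ a b); auto; try lra.
      - repeat apply Rmult_le_pos; lra.
      - intros s t Hs Ht. eapply Rle_trans; [apply HLip; auto|].
        rewrite Rabs_minus_sym. rewrite Rmult_assoc. apply Rmult_le_compat_l; [lra|].
        rewrite <- (Rmult_1_r (Rabs _)).
        apply Rmult_le_compat; try lra; [apply Rabs_pos|apply HE; auto|].
        rewrite <- exp_0 at 1. apply exp_monotone.
        apply Rmult_le_pos; [lra|apply Rabs_pos]. }
    replace (u x y - T u x y) with ((u x y - w (S n) x y) +
      (dint (fun x y => G x y (w n x y)) x y - dint (fun x y => G x y (u x y)) x y))
      by (simpl; unfold T; ring).
    eapply Rle_trans; [apply Rabs_triang|].
    replace (L * (E * (1 / 2) ^ n) / k / k * exp (k * Rabs (x - y))) with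
      (L * E / k / k * exp (k * Rabs (x - y)) * (1 / 2) ^ n) in Q2 by (field; lra).
    pose proof (Rmult_le_pos E ((1 / 2) ^ n) PE Pn). rewrite <- tech_pow_Rmult in Q1.
    rewrite Rmult_plus_distr_r. lra. }
  assert (Su : forall k, Ck k u).
  (* Bootstrap: [T] raises regularity by one order and [u = T u]. *)
  { induction k; [split; auto|].
    apply (Ck_ext (S k) (T u)); [intros; symmetry; auto|]. apply HT, IHk. }
  (* This is the [x]-derivative of [T u]: [u1] comes from [h], the integral from [dint]. *)
  set (ux := fun x y => u1 x + vint (fun x y => G x y (u x y)) x y).
  exists u, ux. split; [exact Su|]. split; [|split; [|split]].
  - intros k. apply Ck_plus; auto. apply Ck_vint, HG, Su.
  - intros x y [Hx Hy]. apply (is_derive_ext_loc (fun t => T u t y)).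
    + apply (filter_imp I); [|apply locally_I, Hx].
      intros t Ht. symmetry. apply Fix. split; auto.
    + apply (is_derive_plus (fun t => h t y)).
      * unfold h. replace (u1 x) with (plus 0 (u1 x)) by (unfold plus; simpl; ring).
        apply (is_derive_plus (fun _ => u0 y)); [exact (is_derive_const _ _)|].
        apply (Dy_vint (fun _ s => u1 s) (Ck_cont 0 _ (H1' O)) y x). split; auto.
      * apply Dx_dint; [apply HG0, Cu | split; auto].
  - intros x y Hu. unfold ux.
    replace (G x y (u x y)) with (plus 0 (G x y (u x y))) by (unfold plus; simpl; ring).
    apply (is_derive_plus (fun _ => u1 x)); [exact (is_derive_const _ _)|].
    apply (Dy_vint (fun x y => G x y (u x y))); auto.
  - intros t Ht. rewrite Fix by (split; auto). unfold T, ux, h, dint, vint.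
    rewrite !RInt_point. unfold zero; simpl. split; ring.
Qed.

(** * Smooth functions and commuting partial derivatives *)

Local Notation smooth f := (forall k, Ck k f).

Lemma Dx_unique (f g h : R -> R -> R) : Dx f g -> Dx f h -> forall x y, U x y -> g x y = h x y.
Proof.
  intros Hg Hh x y Hu. rewrite <- (is_derive_unique _ _ _ (Hg x y Hu)).
  apply is_derive_unique, Hh, Hu.
Qed.

Lemma Dy_unique (f g h : R -> R -> R) : Dy f g -> Dy f h -> forall x y, U x y -> g x y = h x y.
Proof.
  intros Hg Hh x y Hu. rewrite <- (is_derive_unique _ _ _ (Hg x y Hu)).
  apply is_derive_unique, Hh, Hu.
Qed.

Lemma smooth_cont f : smooth f -> cont_U f.
Proof. intros H. apply (Ck_cont 0), H. Qed.

Lemma smooth_Dx f fx : smooth f -> Dx f fx -> smooth fx.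
Proof.
  intros S D k. destruct (S (Datatypes.S k)) as [_ (gx & gy & D1 & _ & C & _)].
  apply (Ck_ext k gx); auto. apply (Dx_unique f); auto.
Qed.

Lemma smooth_Dy f fy : smooth f -> Dy f fy -> smooth fy.
Proof.
  intros S D k. destruct (S (Datatypes.S k)) as [_ (gx & gy & _ & D1 & _ & C)].
  apply (Ck_ext k gy); auto. apply (Dy_unique f); auto.
Qed.

Lemma smooth_ex_Dx f : smooth f -> exists fx, Dx f fx /\ smooth fx.
Proof.
  intros S. destruct (S 1%nat) as [_ (fx & _ & D & _)].
  exists fx. split; auto. apply (smooth_Dx f); auto.
Qed.

Lemma smooth_ex_Dy f : smooth f -> exists fy, Dy f fy /\ smooth fy.
Proof.
  intros S. destruct (S 1%nat) as [_ (_ & fy & _ & D & _)].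
  exists fy. split; auto. apply (smooth_Dy f); auto.
Qed.

Lemma is_derive_ext_I (f g : R -> R) x l :
  (forall t, I t -> f t = g t) -> I x -> is_derive f x l -> is_derive g x l.
Proof.
  intros E Hx. apply is_derive_ext_loc. apply (filter_imp I); [exact E|]. apply locally_I, Hx.
Qed.

Lemma mixed_partials f fx fy fxy fyx :
  smooth f -> Dx f fx -> Dy f fy -> Dy fx fxy -> Dx fy fyx ->
  forall x y, U x y -> fxy x y = fyx x y.
Proof.
  intros S D1 D2 D3 D4 x y Hu.
  assert (E1 : forall u v, U u v -> Derive (fun t => f t v) u = fx u v).
  { intros u v H. apply is_derive_unique, D1, H. }
  assert (E2 : forall u v, U u v -> Derive (fun t => f u t) v = fy u v).
  { intros u v H. apply is_derive_unique, D2, H. }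
  assert (D3' : forall u v, U u v ->
    is_derive (fun z => Derive (fun t => f t z) u) v (fxy u v)).
  { intros u v H. apply (is_derive_ext_I (fun z => fx u z)); [|apply H|auto].
    intros t Ht. symmetry. apply E1. split; [apply H|exact Ht]. }
  assert (D4' : forall u v, U u v ->
    is_derive (fun z => Derive (fun t => f z t) v) u (fyx u v)).
  { intros u v H. apply (is_derive_ext_I (fun z => fy z v)); [|apply H|auto].
    intros t Ht. symmetry. apply E2. split; [exact Ht|apply H]. }
  assert (Cxy : cont_U fxy) by (apply smooth_cont, (smooth_Dy fx), D3; apply (smooth_Dx f); auto).
  assert (Cyx : cont_U fyx) by (apply smooth_cont, (smooth_Dx fy), D4; apply (smooth_Dy f); auto).
  rewrite <- (is_derive_unique _ _ _ (D3' x y Hu)).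
  rewrite <- (is_derive_unique _ _ _ (D4' x y Hu)).
  symmetry. apply Schwarz.
  - apply locally_U; auto. intros u v H. split4.
    + exact (ex_intro _ _ (D1 u v H)).
    + exact (ex_intro _ _ (D2 u v H)).
    + exact (ex_intro _ _ (D4' u v H)).
    + exact (ex_intro _ _ (D3' u v H)).
  - apply (continuity_2d_pt_ext_loc fyx); auto. apply locally_U; auto.
    intros u v H. symmetry. apply is_derive_unique, D4', H.
  - apply (continuity_2d_pt_ext_loc fxy); auto. apply locally_U; auto.
    intros u v H. symmetry. apply is_derive_unique, D3', H.
Qed.

(** Used to find the [y]-derivative of an [x]-derivative when only [f_y] is given by an equation. *)
Lemma Dy_of_mixed f fx fy g :
  smooth f -> Dx f fx -> Dy f fy -> Dx fy g -> Dy fx g.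
Proof.
  intros S D1 D2 D3 x y Hu.
  destruct (smooth_ex_Dy fx) as (fxy & D & _); [apply (smooth_Dx f); auto|].
  rewrite <- (mixed_partials f fx fy fxy g) by auto. auto.
Qed.

Lemma Dx_of_mixed f fx fy g :
  smooth f -> Dx f fx -> Dy f fy -> Dy fx g -> Dx fy g.
Proof.
  intros S D1 D2 D3 x y Hu.
  destruct (smooth_ex_Dx fy) as (fyx & D & _); [apply (smooth_Dy f); auto|].
  rewrite (mixed_partials f fx fy g fyx) by auto. auto.
Qed.

Lemma smooth_smooth2_on f : smooth f -> smooth2_on U f.
Proof.
  intros S.
  set (dx := fun (g : R -> R -> R) x y => Derive (fun t => g t y) x).
  set (dy := fun (g : R -> R -> R) x y => Derive (fun t => g x t) y).
  assert (Hx : forall g, smooth g -> Dx g (dx g)).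
  { intros g Sg x y Hu. destruct (smooth_ex_Dx g Sg) as (h & D & _).
    apply Derive_correct. eexists. apply D, Hu. }
  assert (Hy : forall g, smooth g -> Dy g (dy g)).
  { intros g Sg x y Hu. destruct (smooth_ex_Dy g Sg) as (h & D & _).
    apply Derive_correct. eexists. apply D, Hu. }
  (* All [y]-derivatives are taken first, so raising [i] is immediate; raising [j] must commute a
     [dy] past [i] applications of [dx], by induction on [i]. *)
  set (D := fun i j => Nat.iter i dx (Nat.iter j dy f)).
  assert (SD : forall i j, smooth (D i j)).
  { induction i; intros j.
    - induction j; [exact S|]. exact (smooth_Dy (D O j) (D O (Datatypes.S j)) IHj (Hy (D O j) IHj)).
    - exact (smooth_Dx (D i j) (D (Datatypes.S i) j) (IHi j) (Hx (D i j) (IHi j))). }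
  assert (DX : forall i j, Dx (D i j) (D (Datatypes.S i) j)).
  { intros i j. exact (Hx (D i j) (SD i j)). }
  assert (DY : forall i j, Dy (D i j) (D i (Datatypes.S j))).
  { induction i; intros j.
    - exact (Hy (D O j) (SD O j)).
    - exact (Dy_of_mixed (D i j) (D (Datatypes.S i) j) (D i (Datatypes.S j))
        (D (Datatypes.S i) (Datatypes.S j)) (SD i j) (DX i j) (IHi j) (DX i (Datatypes.S j))). }
  exists D. split; [reflexivity|]. intros i j x y Hu. split; [|split].
  - apply DX, Hu.
  - apply DY, Hu.
  - apply continuity_2d_pt_filterlim, smooth_cont; auto.
Qed.

(** * Real-analytic functions are smooth *)

Lemma pseries_radius a r : (forall x, Rabs x < r -> ex_pseries a x) ->
  forall x, Rabs x < r -> Rbar_lt (Rabs x) (CV_radius a).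
Proof.
  intros H x Hx. apply Rbar_not_le_lt. intros Hc.
  pose proof (Rabs_pos x) as Px.
  (* If the radius of convergence were at most [Rabs x], the terms at the midpoint [z] would not
     tend to zero, although the series converges there. *)
  set (z := (Rabs x + r) / 2).
  assert (Hz : Rabs z = z) by (apply Rabs_pos_eq; unfold z; lra).
  apply (CV_disk_outside a z).
  - eapply Rbar_le_lt_trans; [exact Hc|]. rewrite Hz. unfold z; simpl; lra.
  - apply (is_lim_seq_ext (fun n => scal (pow_n z n) (a n))).
    + intros n. rewrite pow_n_pow. unfold scal; simpl. unfold mult; simpl. ring.
    + apply ex_series_lim_0. apply (H z). rewrite Hz. unfold z; lra.
Qed.

(** Termwise differentiation is valid on the same disc, so the derivative is again analytic and the
    argument can be iterated. *)
Lemma analytic_Derive f : real_analytic_on lo hi f ->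
  real_analytic_on lo hi (Derive f) /\ forall t, I t -> is_derive f t (Derive f t).
Proof.
  intros A.
  assert (Q : forall t0, I t0 -> exists a r, 0 < r /\
    forall t, Rabs (t - t0) < r -> is_derive f t (Derive f t) /\
      is_pseries (PS_derive a) (t - t0) (Derive f t)).
  { intros t0 Ht0. destruct (A t0 Ht0) as (a & r & Pr & Ha). exists a, r. split; [exact Pr|].
    intros t Ht.
    assert (HR : Rbar_lt (Rabs (t - t0)) (CV_radius a)).
    { apply (pseries_radius a r); auto. intros x Hx. exists (f (t0 + x)).
      specialize (Ha (t0 + x)). replace (t0 + x - t0) with x in Ha by ring. exact (Ha Hx). }
    assert (D : is_derive f t (PSeries (PS_derive a) (t - t0))).
    { apply (is_derive_ext_loc (fun s => PSeries a (s - t0))).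
      - assert (Pe : 0 < r - Rabs (t - t0)) by lra.
        exists (mkposreal _ Pe). simpl. intros s Hs. apply is_pseries_unique, Ha.
        unfold ball in Hs; simpl in Hs; unfold AbsRing_ball, abs, minus, plus, opp in Hs; simpl in Hs.
        replace (s - t0) with ((s + - t) + (t - t0)) by ring.
        eapply Rle_lt_trans; [apply Rabs_triang|]. lra.
      - replace (PSeries (PS_derive a) (t - t0)) with (scal 1 (PSeries (PS_derive a) (t - t0)))
          by (unfold scal; simpl; unfold mult; simpl; ring).
        apply (is_derive_comp (PSeries a) (fun s => s - t0)).
        + apply is_derive_PSeries, HR.
        + auto_derive; auto. }
    rewrite (is_derive_unique _ _ _ D). split; [exact D|].
    apply PSeries_correct. apply ex_pseries_derive, HR. }
  split.
  - intros t0 Ht0. destruct (Q t0 Ht0) as (a & r & Pr & H).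
    exists (PS_derive a), r. split; auto. intros t Ht. apply H, Ht.
  - intros t Ht. destruct (Q t Ht) as (a & r & Pr & H). apply H.
    rewrite Rminus_diag, Rabs_R0. exact Pr.
Qed.

Lemma analytic_smooth f : real_analytic_on lo hi f -> smooth (fun x _ => f x).
Proof.
  intros A k. revert f A. induction k; intros f A;
  destruct (analytic_Derive f A) as [A' D];
  (split; [intros x y [Hx Hy]|]); auto.
  - apply (continuity_1d_2d_pt_comp f (fun x _ => x)); [|apply continuity_2d_pt_id1].
    apply continuity_pt_filterlim, (ex_derive_continuous f). eexists. apply D, Hx.
  - apply (continuity_1d_2d_pt_comp f (fun x _ => x)); [|apply continuity_2d_pt_id1].
    apply continuity_pt_filterlim, (ex_derive_continuous f). eexists. apply D, Hx.
  - exists (fun x _ => Derive f x), (fun _ _ => 0). split4; auto using Ck_const.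
    + intros x y [Hx Hy]. apply (D x Hx).
    + intros x y _. exact (is_derive_const (f x) _).
Qed.

(** * The structure functions, from the sine-Gordon type equation *)

Lemma smooth_y (f : R -> R) : smooth (fun x _ => f x) -> smooth (fun _ y => f y).
Proof. intros H k. apply (Ck_flip k (fun x _ => f x)), H. Qed.

Lemma sin_lipschitz u v : Rabs (sin u - sin v) <= Rabs (u - v).
Proof.
  destruct (MVT_gen sin v u cos) as (c & _ & E).
  - intros; apply is_derive_sin.
  - intros; apply continuity_sin.
  - rewrite E, Rabs_mult. rewrite <- (Rmult_1_l (Rabs (u - v))) at 2.
    apply Rmult_le_compat_r; [apply Rabs_pos|]. apply Rabs_le, COS_bound.
Qed.

Lemma cos_lipschitz u v : Rabs (cos u - cos v) <= Rabs (u - v).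
Proof.
  destruct (MVT_gen cos v u (fun t => - sin t)) as (c & _ & E).
  - intros; apply is_derive_cos.
  - intros; apply continuity_cos.
  - rewrite E, Rabs_mult, Rabs_Ropp. rewrite <- (Rmult_1_l (Rabs (u - v))) at 2.
    apply Rmult_le_compat_r; [apply Rabs_pos|]. apply Rabs_le, SIN_bound.
Qed.

(** The angle [phi] vanishes on the diagonal and [kap] is its [x]-derivative. Rotating
    [(p0 y, q0 y)] by [phi] satisfies the two [x]-equations identically; the scalar equation for
    [phi] is exactly [kap_y = - q]. *)
Lemma structure_functions_exist (p0 q0 k0 : R -> R) :
  smooth (fun x _ => p0 x) -> smooth (fun x _ => q0 x) -> smooth (fun x _ => k0 x) ->
  exists p q kap : R -> R -> R,
    smooth p /\ smooth q /\ smooth kap /\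
    Dy kap (fun x y => - q x y) /\
    Dx p (fun x y => kap x y * q x y) /\
    Dx q (fun x y => - (kap x y * p x y)) /\
    forall t, I t -> p t t = p0 t /\ q t t = q0 t /\ kap t t = k0 t.
Proof.
  intros Sp Sq Sk.
  destruct (semilinear_cauchy_problem (fun _ y u => p0 y * sin u - q0 y * cos u)
    (fun _ => 0) k0) as (phi & kap & Sphi & Skap & Dphi & Dkap & Hd).
  - intros k v Cv. destruct (Ck_sin_cos k v Cv).
    apply Ck_minus; apply Ck_mult; auto; apply smooth_y; auto.
  - intros a b Ha Hb.
    destruct (bounded_square _ a b (smooth_cont _ Sp) Ha Hb) as (P & PP & HP).
    destruct (bounded_square _ a b (smooth_cont _ Sq) Ha Hb) as (Q & PQ & HQ).
    exists (P + Q). split; [lra|]. intros x y u v Hx Hy.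
    replace (p0 y * sin u - q0 y * cos u - (p0 y * sin v - q0 y * cos v)) with
      (p0 y * (sin u - sin v) + - (q0 y * (cos u - cos v))) by ring.
    eapply Rle_trans; [apply Rabs_triang|]. rewrite Rabs_Ropp, !Rabs_mult.
    rewrite Rmult_plus_distr_r.
    apply Rplus_le_compat; apply Rmult_le_compat; try apply Rabs_pos;
    auto using sin_lipschitz, cos_lipschitz.
    (* The bound on [p0] is stated in the first coordinate of the square, so [p0 y] is read off at
       [(y, y)]. *)
    + apply (HP y y); auto.
    + apply (HQ y y); auto.
  - intros k. apply Ck_const.
  - exact Sk.
  - set (p := fun x y => p0 y * cos (phi x y) + q0 y * sin (phi x y)).
    set (q := fun x y => q0 y * cos (phi x y) - p0 y * sin (phi x y)).
    exists p, q, kap.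
    assert (Sp' := smooth_y _ Sp). assert (Sq' := smooth_y _ Sq).
    assert (Ds : Dx (fun x y => sin (phi x y)) (fun x y => kap x y * cos (phi x y))).
    { intros x y Hu. apply (is_derive_comp sin (fun t => phi t y)); auto. apply is_derive_sin. }
    assert (Dc : Dx (fun x y => cos (phi x y)) (fun x y => kap x y * - sin (phi x y))).
    { intros x y Hu. apply (is_derive_comp cos (fun t => phi t y)); auto. apply is_derive_cos. }
    repeat match goal with |- _ /\ _ => split end; auto.
    + intros k. destruct (Ck_sin_cos k phi (Sphi k)).
      apply Ck_plus; apply Ck_mult; auto.
    + intros k. destruct (Ck_sin_cos k phi (Sphi k)).
      apply Ck_minus; apply Ck_mult; auto.
    + intros x y Hu. unfold q.
      replace (- (q0 y * cos (phi x y) - p0 y * sin (phi x y))) with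
        (p0 y * sin (phi x y) - q0 y * cos (phi x y)) by ring. auto.
    + intros x y Hu. unfold p.
      replace (kap x y * q x y) with
        (plus (p0 y * (kap x y * - sin (phi x y))) (q0 y * (kap x y * cos (phi x y))))
        by (unfold q, plus; simpl; ring).
      apply (is_derive_plus (fun t => p0 y * cos (phi t y)) (fun t => q0 y * sin (phi t y))).
      * apply (is_derive_scal (fun t => cos (phi t y))), Dc, Hu.
      * apply (is_derive_scal (fun t => sin (phi t y))), Ds, Hu.
    + intros x y Hu. unfold q.
      replace (- (kap x y * p x y)) with
        (minus (q0 y * (kap x y * - sin (phi x y))) (p0 y * (kap x y * cos (phi x y))))
        by (unfold p, minus, plus, opp; simpl; ring).
      apply (is_derive_minus (fun t => q0 y * cos (phi t y)) (fun t => p0 y * sin (phi t y))).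
      * apply (is_derive_scal (fun t => cos (phi t y))), Dc, Hu.
      * apply (is_derive_scal (fun t => sin (phi t y))), Ds, Hu.
    + intros t Ht. destruct (Hd t Ht) as [E1 E2]. unfold p, q.
      rewrite E1, E2, cos_0, sin_0. repeat split; ring.
Qed.

(** * Integration of the frame equations *)

Lemma Dy_0_const (f : R -> R -> R) : Dy f (fun _ _ => 0) ->
  forall x y, U x y -> f x y = f x x.
Proof.
  intros D x y [Hx Hy]. apply Rminus_diag_uniq.
  assert (B : Rabs (f x y - f x x) <= 0 / 1 * exp (1 * Rabs (y - x))).
  (* The growth bound with [C = 0] leaves no room for variation along [y]. *)
  { apply (exp_growth (fun t => f x t - f x x) (fun _ => 0)); try lra.
    - intros s Hs. replace 0 with (minus 0 0) by (unfold minus, plus, opp; simpl; ring).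
      apply (is_derive_minus (fun t => f x t) (fun _ => f x x)).
      + apply D. split; auto. apply (I_convex y x); auto.
      + exact (is_derive_const _ _).
    - intros s _. rewrite Rabs_R0. lra. }
  replace (0 / 1 * exp (1 * Rabs (y - x))) with 0 in B by field.
  destruct (Req_dec (f x y - f x x) 0) as [E|E]; auto.
  apply Rabs_pos_lt in E. lra.
Qed.

(** Together the equations give [(B_y)_x = p B] with zero data. Starting from a crude bound on [B],
    each passage through the two integrations halves it in the weighted norm, so [B] vanishes, and
    then so does [A = - B_y]. *)
Lemma linear_cauchy_unique (A B p : R -> R -> R) :
  cont_U p -> cont_U B ->
  Dx A (fun x y => - (p x y * B x y)) -> Dy B (fun x y => - A x y) ->
  (forall t, I t -> A t t = 0 /\ B t t = 0) ->
  forall x y, U x y -> A x y = 0 /\ B x y = 0.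
Proof.
  intros Cp CB DA DB H0.
  assert (HB : forall x y, U x y -> B x y = 0).
  { intros x0 y0 [Hx0 Hy0].
    destruct (I_widen2 x0 y0 Hx0 Hy0) as (a & b & Ha & Hb & Hxab & Hyab).
    destruct (bounded_square p a b Cp Ha Hb) as (P & PP & HP).
    destruct (bounded_square B a b CB Ha Hb) as (M & PM & HM).
    set (k := 1 + 2 * P). assert (Pk : 0 < k) by (unfold k; lra).
    assert (Hk : P / k / k <= 1 / 2).
    { replace (P / k / k) with (P / (k * k)) by (field; lra).
      apply Rle_div_l; [apply Rmult_lt_0_compat; lra|]. unfold k.
      pose proof (Rmult_lt_0_compat P P PP PP). lra. }
    assert (HU : forall u v, a <= u <= b -> a <= v <= b -> U u v).
    { intros u v Hu Hv. split; apply (I_between a b); auto. }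
    assert (W : forall n x y, a <= x <= b -> a <= y <= b ->
      Rabs (B x y) <= M * (1 / 2) ^ n * exp (k * Rabs (x - y))).
    { induction n; intros x y Hx Hy.
      - eapply Rle_trans; [apply HM; auto|]. rewrite pow_O, Rmult_1_r.
        rewrite <- (Rmult_1_r M) at 1. apply Rmult_le_compat_l; [lra|].
        rewrite <- exp_0 at 1. apply exp_monotone.
        apply Rmult_le_pos; [lra|apply Rabs_pos].
      - assert (Pn : 0 <= (1 / 2) ^ n) by (apply pow_le; lra).
        assert (PMn : 0 <= M * (1 / 2) ^ n) by (apply Rmult_le_pos; lra).
        assert (PPM : 0 <= P * (M * (1 / 2) ^ n)) by (apply Rmult_le_pos; lra).
        eapply Rle_trans.
        + apply (exp_growth (fun t => B x t) (fun t => - A x t) y x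
            (P * (M * (1 / 2) ^ n) / k) k); auto.
          * apply Rdiv_le_0_compat; lra.
          * apply H0. apply (HU x x); auto.
          * intros t Ht. apply DB, HU; auto. apply (between_square a b y x); auto.
          * intros t Ht.
            assert (Hta : a <= t <= b) by (apply (between_square a b y x); auto).
            rewrite Rabs_Ropp, (Rabs_minus_sym t x).
            apply (exp_growth (fun s => A s t) (fun s => - (p s t * B s t)) x t); auto.
            -- apply H0. apply (HU t t); auto.
            -- intros s Hs. apply DA, HU; auto. apply (between_square a b x t); auto.
            -- intros s Hs.
               assert (Hsa : a <= s <= b) by (apply (between_square a b x t); auto).
               rewrite Rabs_Ropp, Rabs_mult, Rmult_assoc.
               apply Rmult_le_compat; auto using Rabs_pos.
        + rewrite (Rabs_minus_sym y x).
          apply Rmult_le_compat_r; [apply Rlt_le, exp_pos|].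
          replace (P * (M * (1 / 2) ^ n) / k / k) with ((P / k / k) * (M * (1 / 2) ^ n))
            by (field; lra).
          rewrite <- tech_pow_Rmult.
          replace (M * (1 / 2 * (1 / 2) ^ n)) with (1 / 2 * (M * (1 / 2) ^ n)) by ring.
          apply Rmult_le_compat_r; auto. }
    apply (eq_0_of_half_pow (M * exp (k * Rabs (x0 - y0)))). intros n.
    replace (M * exp (k * Rabs (x0 - y0)) * (1 / 2) ^ n) with
      (M * (1 / 2) ^ n * exp (k * Rabs (x0 - y0))) by ring.
    apply W; lra. }
  intros x y Hu. split; auto.
  assert (D0 : is_derive (fun t => B x t) y 0).
  { apply (is_derive_ext_I (fun _ => 0)); [|apply Hu|exact (is_derive_const _ _)].
    intros t Ht. symmetry. apply HB. split; [apply Hu|exact Ht]. }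
  pose proof (is_derive_unique _ _ _ (DB x y Hu)) as E.
  rewrite (is_derive_unique _ _ _ D0) in E. lra.
Qed.

(** This treats one scalar coordinate of the frame. The coefficient [1 + p] appears because a
    diagonal derivative is [f_x + f_y]: for [e0] these are [e1] and [p e1 + q e2]. The system is
    overdetermined: [e0], [e1] come from [e0_xy = p e0] and [e2] from its [y]-equation; the other
    equations follow by compatibility. *)
Lemma frame_component (p q kap : R -> R -> R) (n0 n1 j : R -> R) :
  smooth p -> smooth q -> smooth kap ->
  Dy kap (fun x y => - q x y) ->
  Dx p (fun x y => kap x y * q x y) ->
  Dx q (fun x y => - (kap x y * p x y)) ->
  smooth (fun x _ => n0 x) -> smooth (fun x _ => n1 x) -> smooth (fun x _ => j x) ->
  (forall t, I t -> is_derive n0 t ((1 + p t t) * n1 t + q t t * j t)) ->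
  (forall t, I t -> is_derive n1 t ((1 + p t t) * n0 t + kap t t * j t)) ->
  (forall t, I t -> is_derive j t (q t t * n0 t - kap t t * n1 t)) ->
  exists e0 e1 e2 : R -> R -> R,
    smooth e0 /\ Dx e0 e1 /\
    Dy e0 (fun x y => p x y * e1 x y + q x y * e2 x y) /\
    Dy e1 (fun x y => p x y * e0 x y) /\
    Dy e2 (fun x y => q x y * e0 x y) /\
    forall t, I t -> e0 t t = n0 t /\ e1 t t = n1 t /\ e2 t t = j t.
Proof.
  intros Sp Sq Sk Dk Dp Dq S0 S1 Sj D0 D1 Dj.
  destruct (semilinear_cauchy_problem (fun x y u => p x y * u) n0 n1)
    as (e0 & e1 & Se0 & Se1 & De0 & De1 & Hd); auto.
  { intros k v Cv. apply Ck_mult; auto. }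
  { intros a b Ha Hb.
    destruct (bounded_square p a b (smooth_cont _ Sp) Ha Hb) as (P & PP & HP).
    exists P. split; [lra|]. intros x y u v Hx Hy.
    rewrite <- Rmult_minus_distr_l, Rabs_mult.
    apply Rmult_le_compat_r; [apply Rabs_pos|auto]. }
  set (e2 := fun x y => j x + vint (fun x y => q x y * e0 x y) x y).
  assert (Sqe : smooth (fun x y => q x y * e0 x y)) by (intros k; apply Ck_mult; auto).
  assert (Spe : smooth (fun x y => p x y * e0 x y)) by (intros k; apply Ck_mult; auto).
  assert (Se2 : smooth e2).
  { intros k. apply Ck_plus; auto. apply Ck_vint, Sqe. }
  assert (De2 : Dy e2 (fun x y => q x y * e0 x y)).
  { intros x y Hu. unfold e2.
    replace (q x y * e0 x y) with (plus 0 (q x y * e0 x y)) by (unfold plus; simpl; ring).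
    apply (is_derive_plus (fun _ => j x)); [exact (is_derive_const _ _)|].
    apply (Dy_vint (fun x y => q x y * e0 x y)); auto using smooth_cont. }
  assert (He2 : forall t, I t -> e2 t t = j t).
  { intros t Ht. unfold e2, vint. rewrite RInt_point. unfold zero; simpl. ring. }
  destruct (smooth_ex_Dx e2 Se2) as (e2x & De2x & Se2x).
  destruct (smooth_ex_Dx e1 Se1) as (e1x & De1x & Se1x).
  destruct (smooth_ex_Dy e0 Se0) as (e0y & De0y & Se0y).
  assert (De0yx : Dx e0y (fun x y => p x y * e0 x y)).
  { apply (Dx_of_mixed e0 e1); auto. }
  assert (De1xy : Dy e1x (fun x y => kap x y * q x y * e0 x y + p x y * e1 x y)).
  { apply (Dy_of_mixed e1 e1x (fun x y => p x y * e0 x y)); auto.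
    intros x y Hu. apply (is_derive_mult (fun t => p t y) (fun t => e0 t y)); auto.
    intros; apply Rmult_comm. }
  assert (De2xy : Dy e2x (fun x y => - (kap x y * p x y) * e0 x y + q x y * e1 x y)).
  { apply (Dy_of_mixed e2 e2x (fun x y => q x y * e0 x y)); auto.
    intros x y Hu. apply (is_derive_mult (fun t => q t y) (fun t => e0 t y)); auto.
    intros; apply Rmult_comm. }
  (* Comparing the derivative along the diagonal with that of the curve recovers the partial
     derivative not yet known there. *)
  assert (Hdiag : forall (f fx fy : R -> R -> R) (n : R -> R) t l, smooth f -> Dx f fx -> Dy f fy ->
    (forall t, I t -> f t t = n t) -> I t -> is_derive n t l -> fx t t + fy t t = l).
  { intros f fx fy n t l Sf Fx Fy E Ht Hn.
    assert (Q : is_derive n t (fx t t + fy t t)).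
    { apply (is_derive_ext_I (fun t => f t t)); auto. apply is_derive_diag; auto.
      apply smooth_cont, (smooth_Dx f); auto. }
    rewrite <- (is_derive_unique _ _ _ Q). apply is_derive_unique, Hn. }
  (* The defect [e2x + kap e1] has zero [y]-derivative, by the equations for [q_x] and [kap_y], and
     vanishes on the diagonal. *)
  assert (HC : forall x y, U x y -> e2x x y = - (kap x y * e1 x y)).
  { assert (HC0 : forall t, I t -> e2x t t + kap t t * e1 t t = 0).
    { intros t Ht. destruct (Hd t Ht) as [E0 E1].
      pose proof (Hdiag e2 e2x _ j t _ Se2 De2x De2 He2 Ht (Dj t Ht)) as Q.
      simpl in Q. rewrite E0 in Q. rewrite E1. lra. }
    intros x y Hu.
    assert (HC : e2x x y + kap x y * e1 x y = 0).
    { rewrite (Dy_0_const (fun x y => e2x x y + kap x y * e1 x y)); auto.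
      - apply HC0, Hu.
      - intros u v H.
        replace 0 with (plus (- (kap u v * p u v) * e0 u v + q u v * e1 u v)
          (plus (mult (- q u v) (e1 u v)) (mult (kap u v) (p u v * e0 u v))))
          by (unfold plus, mult; simpl; ring).
        apply (is_derive_plus (fun t => e2x u t) (fun t => kap u t * e1 u t)); auto.
        apply (is_derive_mult (fun t => kap u t) (fun t => e1 u t)); auto.
        intros; apply Rmult_comm. }
    lra. }
  (* [A] and [B] are the defects of [e0_y = p e1 + q e2] and [e1_x = e0 + kap e2]. They satisfy
     [A_x = - p B], [B_y = - A] and vanish on the diagonal. *)
  set (A := fun x y => e0y x y - (p x y * e1 x y + q x y * e2 x y)).
  set (B := fun x y => e1x x y - (e0 x y + kap x y * e2 x y)).
  assert (HA : forall x y, U x y -> A x y = 0 /\ B x y = 0).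
  { apply (linear_cauchy_unique A B p).
    - apply smooth_cont, Sp.
    - apply smooth_cont. intros k. apply Ck_minus; auto.
      apply Ck_plus; auto. apply Ck_mult; auto.
    - intros x y Hu.
      replace (- (p x y * B x y)) with
        (minus (p x y * e0 x y)
          (plus (plus (mult (kap x y * q x y) (e1 x y)) (mult (p x y) (e1x x y)))
                (plus (mult (- (kap x y * p x y)) (e2 x y)) (mult (q x y) (e2x x y)))))
        by (rewrite HC by auto; unfold B, minus, plus, opp, mult; simpl; ring).
      apply (is_derive_minus (fun t => e0y t y)
        (fun t => p t y * e1 t y + q t y * e2 t y)); auto.
      apply (is_derive_plus (fun t => p t y * e1 t y) (fun t => q t y * e2 t y)).
      + apply (is_derive_mult (fun t => p t y) (fun t => e1 t y)); auto.
        intros; apply Rmult_comm.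
      + apply (is_derive_mult (fun t => q t y) (fun t => e2 t y)); auto.
        intros; apply Rmult_comm.
    - intros x y Hu.
      replace (- A x y) with
        (minus (kap x y * q x y * e0 x y + p x y * e1 x y)
          (plus (e0y x y)
                (plus (mult (- q x y) (e2 x y)) (mult (kap x y) (q x y * e0 x y)))))
        by (unfold A, minus, plus, opp, mult; simpl; ring).
      apply (is_derive_minus (fun t => e1x x t) (fun t => e0 x t + kap x t * e2 x t)); auto.
      apply (is_derive_plus (fun t => e0 x t) (fun t => kap x t * e2 x t)); auto.
      apply (is_derive_mult (fun t => kap x t) (fun t => e2 x t)); auto.
      intros; apply Rmult_comm.
    - intros t Ht. destruct (Hd t Ht) as [E0 E1]. unfold A, B.
      pose proof (Hdiag e0 e1 e0y n0 t _ Se0 De0 De0y (fun t H => proj1 (Hd t H)) Ht (D0 t Ht)) as Q0.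
      pose proof (Hdiag e1 e1x _ n1 t _ Se1 De1x De1 (fun t H => proj2 (Hd t H)) Ht (D1 t Ht)) as Q1.
      simpl in Q1. rewrite (He2 t Ht). rewrite E0, E1 in *. lra. }
  exists e0, e1, e2.
  repeat match goal with |- _ /\ _ => split end; auto.
  - intros x y Hu. destruct (HA x y Hu) as [E _].
    replace (p x y * e1 x y + q x y * e2 x y) with (e0y x y) by (unfold A in E; lra). auto.
  - intros t Ht. destruct (Hd t Ht). auto.
Qed.
(** The matrix of the [y]-equations lies in so(2,1), so the terms of the product rule cancel in
    pairs. Here [e] and [f] stand for two coordinates of the same frame. *)
Lemma dual_metric_const (p q e0 e1 e2 f0 f1 f2 : R -> R -> R) :
  Dy e0 (fun x y => p x y * e1 x y + q x y * e2 x y) ->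
  Dy e1 (fun x y => p x y * e0 x y) -> Dy e2 (fun x y => q x y * e0 x y) ->
  Dy f0 (fun x y => p x y * f1 x y + q x y * f2 x y) ->
  Dy f1 (fun x y => p x y * f0 x y) -> Dy f2 (fun x y => q x y * f0 x y) ->
  forall x y, U x y ->
    - (e0 x y * f0 x y) + e1 x y * f1 x y + e2 x y * f2 x y =
    - (e0 x x * f0 x x) + e1 x x * f1 x x + e2 x x * f2 x x.
Proof.
  intros E0 E1 E2 F0 F1 F2.
  apply (Dy_0_const (fun x y => - (e0 x y * f0 x y) + e1 x y * f1 x y + e2 x y * f2 x y)).
  intros x y Hu.
  specialize (E0 x y Hu). specialize (E1 x y Hu). specialize (E2 x y Hu).
  specialize (F0 x y Hu). specialize (F1 x y Hu). specialize (F2 x y Hu).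
  pose proof (is_derive_plus _ _ y _ _ (is_derive_plus _ _ y _ _
    (is_derive_opp _ y _ (is_derive_mult _ _ y _ _ E0 F0 Rmult_comm))
    (is_derive_mult _ _ y _ _ E1 F1 Rmult_comm))
    (is_derive_mult _ _ y _ _ E2 F2 Rmult_comm)) as D.
  match type of D with is_derive _ _ ?l =>
    replace 0 with l by (unfold plus, opp, mult; simpl; ring) end.
  exact D.
Qed.

(** * The moving frame along the initial curve *)

Definition sl2_smooth (X : R -> sl2) : Prop :=
  smooth (fun x _ => sl_a (X x)) /\ smooth (fun x _ => sl_b (X x)) /\
  smooth (fun x _ => sl_c (X x)).

Lemma smooth_ip X Y : sl2_smooth X -> sl2_smooth Y -> smooth (fun x _ => ip (X x) (Y x)).
Proof.
  intros (X1 & X2 & X3) (Y1 & Y2 & Y3) k.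
  apply (Ck_ext k (fun x _ => sl_a (X x) * sl_a (Y x)
    + (sl_b (X x) * sl_c (Y x) + sl_c (X x) * sl_b (Y x)) * / 2)).
  { intros x y _. symmetry. apply ip_coord. }
  repeat first [apply (Ck_plus k) | apply (Ck_mult k)]; auto using Ck_const.
Qed.

Lemma smooth_half_bracket X Y :
  sl2_smooth X -> sl2_smooth Y -> sl2_smooth (fun t => half_bracket (X t) (Y t)).
Proof.
  intros (X1 & X2 & X3) (Y1 & Y2 & Y3). unfold sl2_smooth. simpl.
  refine (conj _ (conj _ _)); intros k; unfold Rdiv;
  repeat first [apply (Ck_mult k) | apply (Ck_minus k)]; auto using Ck_const.
Qed.

Lemma sl2_analytic_smooth X : sl2_analytic_on lo hi X ->
  sl2_smooth X /\ sl2_smooth (sl2_Derive X) /\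
  forall t, I t -> sl2_is_derive X t (sl2_Derive X t).
Proof.
  intros (A & B & C).
  destruct (analytic_Derive _ A) as [A' DA], (analytic_Derive _ B) as [B' DB],
    (analytic_Derive _ C) as [C' DC].
  refine (conj (conj _ (conj _ _)) (conj (conj _ (conj _ _)) _));
  try (apply (analytic_smooth (fun t => _)); assumption).
  intros t Ht. refine (conj _ (conj _ _)); [apply DA | apply DB | apply DC]; exact Ht.
Qed.

Lemma ip_constant_derive X Y c t V W :
  (forall s, I s -> ip (X s) (Y s) = c) -> I t ->
  sl2_is_derive X t V -> sl2_is_derive Y t W -> ip V (Y t) + ip (X t) W = 0.
Proof.
  intros H Ht HX HY. pose proof (is_derive_ip X Y t V W HX HY) as D.
  rewrite <- (is_derive_unique _ _ _ D). apply is_derive_unique.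
  apply (is_derive_ext_I (fun _ => c)); auto.
  - intros s Hs. symmetry. auto.
  - exact (is_derive_const _ _).
Qed.

Lemma ip_sym X Y : ip X Y = ip Y X.
Proof. rewrite !ip_coord. field. Qed.

(* The structure equations along the curve: in the orthonormal frame [N0], [N1], [J] the derivative is given by a matrix of so(2,1). *)
Lemma frenet_equations (N0 N1 : R -> sl2) t V W :
  let J s := half_bracket (N0 s) (N1 s) in
  (forall s, I s -> in_H2 (N0 s)) -> (forall s, I s -> in_S21 (N1 s)) ->
  (forall s, I s -> ip (N1 s) (N0 s) = 0) -> I t ->
  sl2_is_derive N0 t V -> sl2_is_derive N1 t W ->
  V = sl2_add (sl2_scal (ip V (N1 t)) (N1 t)) (sl2_scal (ip V (J t)) (J t)) /\
  W = sl2_add (sl2_scal (ip V (N1 t)) (N0 t)) (sl2_scal (ip W (J t)) (J t)) /\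
  sl2_is_derive J t
    (sl2_add (sl2_scal (ip V (J t)) (N0 t)) (sl2_scal (- ip W (J t)) (N1 t))).
Proof.
  intros J H0 H1 H01 Ht DV DW.
  pose proof (dual_frame_of_orthonormal _ _ (H0 t Ht) (H1 t Ht) (H01 t Ht)) as F.
  fold (J t) in F.
  (* Differentiating the orthonormality relations gives [<V,N0> = 0], [<W,N1> = 0] and
     [<W,N0> = - <V,N1>]; these fix all but three coefficients. *)
  pose proof (ip_constant_derive N0 N0 _ t V V H0 Ht DV DV) as Q0.
  pose proof (ip_constant_derive N1 N1 _ t W W H1 Ht DW DW) as Q1.
  pose proof (ip_constant_derive N1 N0 _ t W V H01 Ht DW DV) as Q01.
  rewrite (ip_sym (N0 t)) in Q0. rewrite (ip_sym (N1 t)) in Q1, Q01.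
  assert (EV : V = sl2_add (sl2_scal (ip V (N1 t)) (N1 t)) (sl2_scal (ip V (J t)) (J t))).
  { rewrite (dual_frame_expand _ _ _ V F) at 1.
    replace (ip V (N0 t)) with 0 by lra. apply sl2_ext; simpl; ring. }
  assert (EW : W = sl2_add (sl2_scal (ip V (N1 t)) (N0 t)) (sl2_scal (ip W (J t)) (J t))).
  { rewrite (dual_frame_expand _ _ _ W F) at 1.
    replace (ip W (N1 t)) with 0 by lra.
    replace (ip W (N0 t)) with (- ip V (N1 t)) by lra. apply sl2_ext; simpl; ring. }
  split; [exact EV|split; [exact EW|]].
  pose proof (sl2_is_derive_half_bracket N0 N1 t V W DV DW) as D.
  destruct (half_bracket_frame _ _ (H0 t Ht) (H1 t Ht) (H01 t Ht)) as [B0 B1].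
  fold (J t) in B0, B1.
  replace (sl2_add (sl2_scal (ip V (J t)) (N0 t)) (sl2_scal (- ip W (J t)) (N1 t)))
    with (sl2_add (half_bracket V (N1 t)) (half_bracket (N0 t) W)); [exact D|].
  rewrite EV at 1. rewrite EW at 1.
  generalize (ip V (N1 t)) (ip V (J t)) (ip W (J t)). intros P Q K.
  (* The terms with [P] pair [N1] with [N1] and [N0] with [N0], so their brackets vanish. *)
  transitivity (sl2_add (sl2_scal Q (half_bracket (J t) (N1 t)))
    (sl2_scal K (half_bracket (N0 t) (J t)))).
  - generalize (J t). intros X. apply sl2_ext; simpl; field.
  - rewrite B0, B1. apply sl2_ext; simpl; ring.
Qed.

End Square.

(** * Assembly of the harmonic map from its coordinates *)

Theorem mainTheorem2 (lo hi : Rbar) (N0 N1 : R -> sl2) :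
  Rbar_lt lo hi ->
  sl2_analytic_on lo hi N0 ->
  sl2_analytic_on lo hi N1 ->
  (forall t, in_I lo hi t -> in_H2 (N0 t)) ->
  (forall t, in_I lo hi t -> in_S21 (N1 t)) ->
  (forall t, in_I lo hi t -> ip (N1 t) (N0 t) = 0) ->
  (exists t, in_I lo hi t /\
     ip (N1 t) (sl2_sub (sl2_Derive N0 t) (N1 t)) <> 0) ->
  exists nu : R -> R -> sl2,
    lorentz_harmonic lo hi nu /\
    (forall t, in_I lo hi t -> nu t t = N0 t) /\
    (forall t, in_I lo hi t -> d_x nu t t = N1 t).
Proof.
  intros _ A0 A1 H0 H1 H01 _.
  set (J := fun s => half_bracket (N0 s) (N1 s)).
  destruct (sl2_analytic_smooth lo hi N0 A0) as (S0 & SD0 & D0).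
  destruct (sl2_analytic_smooth lo hi N1 A1) as (S1 & SD1 & D1).
  pose proof (smooth_half_bracket lo hi N0 N1 S0 S1) as SJ. fold J in SJ.
  (* On the diagonal [nu_y = N0' - N1], and [p], [q] are its components along [N1] and [J]; the unit
     norm of [N1] accounts for the subtracted 1. *)
  destruct (structure_functions_exist lo hi
    (fun t => ip (sl2_Derive N0 t) (N1 t) - 1)
    (fun t => ip (sl2_Derive N0 t) (J t))
    (fun t => ip (sl2_Derive N1 t) (J t)))
    as (p & q & kap & Sp & Sq & Sk & Dk & Dp & Dq & Hpqk).
  { intros k. apply Ck_minus; [apply smooth_ip; assumption | apply Ck_const]. }
  { apply smooth_ip; assumption. }
  { apply smooth_ip; assumption. }
  assert (F : forall t, in_I lo hi t ->
    sl2_is_derive N0 t (sl2_add (sl2_scal (1 + p t t) (N1 t)) (sl2_scal (q t t) (J t))) /\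
    sl2_is_derive N1 t (sl2_add (sl2_scal (1 + p t t) (N0 t)) (sl2_scal (kap t t) (J t))) /\
    sl2_is_derive J t (sl2_add (sl2_scal (q t t) (N0 t)) (sl2_scal (- kap t t) (N1 t)))).
  { intros t Ht. destruct (Hpqk t Ht) as (-> & -> & ->).
    replace (1 + (ip (sl2_Derive N0 t) (N1 t) - 1)) with (ip (sl2_Derive N0 t) (N1 t)) by ring.
    destruct (frenet_equations lo hi N0 N1 t _ _ H0 H1 H01 Ht (D0 t Ht) (D1 t Ht))
      as (E0 & E1 & DJ).
    change (half_bracket (N0 t) (N1 t)) with (J t) in E0, E1, DJ.
    rewrite <- E0, <- E1. auto. }
  (* The frame equations are linear with scalar coefficients, so they are solved separately for each
     coordinate functional [f], with the same [p], [q], [kap]. *)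
  assert (C : forall f : sl2 -> R,
    (forall X Y, f (sl2_add X Y) = f X + f Y) ->
    (forall k X, f (sl2_scal k X) = k * f X) ->
    (forall X t V, sl2_is_derive X t V -> is_derive (fun s => f (X s)) t (f V)) ->
    (forall X, sl2_smooth lo hi X -> forall k, Ck lo hi k (fun x _ => f (X x))) ->
    exists e0 e1 e2 : R -> R -> R,
      (forall k, Ck lo hi k e0) /\
      (forall x y, in_IxI lo hi x y -> is_derive (fun t => e0 t y) x (e1 x y)) /\
      (forall x y, in_IxI lo hi x y ->
         is_derive (fun t => e0 x t) y (p x y * e1 x y + q x y * e2 x y)) /\
      (forall x y, in_IxI lo hi x y -> is_derive (fun t => e1 x t) y (p x y * e0 x y)) /\
      (forall x y, in_IxI lo hi x y -> is_derive (fun t => e2 x t) y (q x y * e0 x y)) /\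
      forall t, in_I lo hi t -> e0 t t = f (N0 t) /\ e1 t t = f (N1 t) /\ e2 t t = f (J t)).
  { intros f fD fZ fd fs. apply (frame_component lo hi p q kap); auto;
    intros t Ht; destruct (F t Ht) as (F0 & F1 & F2).
    - rewrite <- !fZ, <- fD. apply fd, F0.
    - rewrite <- !fZ, <- fD. apply fd, F1.
    - replace (q t t * f (N0 t) - kap t t * f (N1 t)) with
        (q t t * f (N0 t) + - kap t t * f (N1 t)) by ring.
      rewrite <- !fZ, <- fD. apply fd, F2. }
  destruct (C sl_a) as (a0 & a1 & a2 & Sa & Ax & Ay0 & Ay1 & Ay2 & Ad);
    try reflexivity; [intros X t V E; apply E | intros X E; apply E |].
  destruct (C sl_b) as (b0 & b1 & b2 & Sb & Bx & By0 & By1 & By2 & Bd);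
    try reflexivity; [intros X t V E; apply E | intros X E; apply E |].
  destruct (C sl_c) as (c0 & c1 & c2 & Sc & Cx & Cy0 & Cy1 & Cy2 & Cd);
    try reflexivity; [intros X t V E; apply E | intros X E; apply E |].
  set (nu := fun x y => SL2 (a0 x y) (b0 x y) (c0 x y)).
  assert (Hx : forall x y, in_IxI lo hi x y -> d_x nu x y = SL2 (a1 x y) (b1 x y) (c1 x y)).
  { intros x y Hu. apply sl2_ext; simpl; apply is_derive_unique; auto. }
  exists nu. split; [split; [|split]|split].
  - refine (conj _ (conj _ _)); apply smooth_smooth2_on; assumption.
  - intros x y Hu.
    (* The inverse-metric identities are carried along [y] to the diagonal point [(x, x)], where the
       frame is [N0 x], [N1 x], [J x]. *)
    apply (in_H2_of_dual_frame _ (SL2 (a1 x y) (b1 x y) (c1 x y)) (SL2 (a2 x y) (b2 x y) (c2 x y))).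
    destruct Hu as [Hxi Hyi]. pose proof (conj Hxi Hyi : in_IxI lo hi x y) as Hu.
    pose proof (dual_frame_of_orthonormal _ _ (H0 x Hxi) (H1 x Hxi) (H01 x Hxi)
      : dual_frame (N0 x) (N1 x) (J x)) as G.
    clearbody J.
    destruct (Ad x Hxi) as (A_0 & A_1 & A_2), (Bd x Hxi) as (B_0 & B_1 & B_2),
      (Cd x Hxi) as (C_0 & C_1 & C_2).
    unfold dual_frame in *; simpl in *.
    rewrite <- A_0, <- A_1, <- A_2, <- B_0, <- B_1, <- B_2, <- C_0, <- C_1, <- C_2 in G.
    rewrite (dual_metric_const lo hi p q a0 a1 a2 a0 a1 a2), (dual_metric_const lo hi p q a0 a1 a2 b0 b1 b2),
      (dual_metric_const lo hi p q a0 a1 a2 c0 c1 c2), (dual_metric_const lo hi p q b0 b1 b2 b0 b1 b2),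
      (dual_metric_const lo hi p q b0 b1 b2 c0 c1 c2), (dual_metric_const lo hi p q c0 c1 c2 c0 c1 c2)
      by assumption.
    exact G.
  (* The factor is [p], because every coordinate satisfies [e1_y = p e0]. *)
  - intros x y Hu. exists (p x y).
    assert (Hy : forall t, in_I lo hi t -> d_x nu x t = SL2 (a1 x t) (b1 x t) (c1 x t)).
    { intros t Ht. apply Hx. split; [apply Hu|exact Ht]. }
    unfold d_xy, d_y. apply sl2_ext; simpl sl_a; simpl sl_b; simpl sl_c;
    apply is_derive_unique.
    + apply (is_derive_ext_I lo hi (fun t => a1 x t)); [|apply Hu|auto].
      intros t Ht. exact (f_equal sl_a (eq_sym (Hy t Ht))).
    + apply (is_derive_ext_I lo hi (fun t => b1 x t)); [|apply Hu|auto].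
      intros t Ht. exact (f_equal sl_b (eq_sym (Hy t Ht))).
    + apply (is_derive_ext_I lo hi (fun t => c1 x t)); [|apply Hu|auto].
      intros t Ht. exact (f_equal sl_c (eq_sym (Hy t Ht))).
  - intros t Ht. apply sl2_ext; simpl; [apply Ad | apply Bd | apply Cd]; exact Ht.
  - intros t Ht. rewrite Hx by (split; exact Ht).
    apply sl2_ext; simpl; [apply Ad | apply Bd | apply Cd]; exact Ht.
Qed.
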